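(* Let $\mathbf{k}$ be a field, $H$ a cocommutative Hopf algebra over $\mathbf{k}$, and let $(L,[\cdot*\cdot]_L)$ and $(M,[\cdot*\cdot]_M)$ be two Lie $H$-pseudoalgebras. Let $\mathrm{Ext}_{nab}(L,M)$ be the set of all equivalence classes of non-abelian extensions of $L$ by $M$, and let $H^2_{nab}(L,M)$ be the set of all equivalence classes of non-abelian $2$-cocycles of $L$ with values in $M$. Then there is a bijection $$\mathrm{Ext}_{nab}(L,M)\cong H^2_{nab}(L,M).$$
   Context: **Basic conventions.** $\otimes=\otimes_{\mathbf k}$; $\Delta(h)=h_{(1)}\otimes h_{(2)}$ (Sweedler). $H^{\otimes n}$ is a left $H^{\otimes n}$-module by multiplication and a right $H$-module via the iterated comultiplication. Since $H$ is cocommutative, permutations of the tensor factors of $H^{\otimes n}$ are right $H$-linear and induce maps on $H^{\otimes n}\otimes_H Z$ for every left $H$-module $Z$. Here $\sigma_{12}$ interchanges the first two tensor factors (of $H^{\otimes 2}$ or $H^{\otimes 3}$), and $\sigma_{1\to 3}(h_3\otimes h_1\otimes h_2)=h_1\otimes h_2\otimes h_3$ on $H^{\otimes 3}$. For left $H$-modules $X,Y,Z$, a $\mathbf k$-linear map $A:X\otimes Y\to H^{\otimes 2}\otimes_H Z$ is $H^{\otimes 2}$-linear if $A(fx,gy)=((f\otimes g)\otimes_H 1)A(x,y)$ for $f,g\in H$; $\mathrm{Hom}_{H^{\otimes 2}}(X\otimes Y,H^{\otimes 2}\otimes_H Z)$ is the set of such maps. If $X=Y$, $A$ is skew-symmetric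 if $A(y,x)=-(\sigma_{12}\otimes_H 1)A(x,y)$. Compositions: for $w=\sum_i(f_i\otimes g_i)\otimes_H e_i\in H^{\otimes 2}\otimes_H X$ and $A(e_i,z)=\sum_j(f_{ij}\otimes g_{ij})\otimes_H e_{ij}$ put $A(w,z)=\sum_{i,j}(f_if_{ij(1)}\otimes g_if_{ij(2)}\otimes g_{ij})\otimes_H e_{ij}\in H^{\otimes 3}\otimes_H Z$. For $w=\sum_i(h_i\otimes l_i)\otimes_H d_i\in H^{\otimes 2}\otimes_H Y$ and $A(x,d_i)=\sum_j(h_{ij}\otimes l_{ij})\otimes_H d_{ij}$ put $A(x,w)=\sum_{i,j}(h_{ij}\otimes h_il_{ij(1)}\otimes l_il_{ij(2)})\otimes_H d_{ij}\in H^{\otimes 3}\otimes_H Z$. **Lie $H$-pseudoalgebra.** A left $H$-module $L$ with a skew-symmetric $H^{\otimes 2}$-linear map $[\cdot*\cdot]_L:L\otimes L\to H^{\otimes 2}\otimes_H L$ satisfying the Jacobi identity $[[x*y]_L*z]_L=[x*[y*z]_L]_L-(\sigma_{12}\otimes_H 1)[y*[x*z]_L]_L$. A homomorphism $\Theta:L\to L'$ is an $H$-linear map with $[\Theta(x)*\Theta(y)]_{L'}=(\mathrm{id}_{H^{\otimes 2}}\otimes_H\Theta)[x*y]_L$. **Non-abelian extensions.** A non-abelian extension of $L$ by $M$ is a Lie $H$-pseudoalgebra $E$ equipped with a short exact sequence of Lie $H$-pseudoalgebras $0\to M\xrightarrow{i}E\xrightarrow{p}L\to 0$. Two extensions $(E,i,p)$,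 $(E',i',p')$ are equivalent if there is a homomorphism $\Theta:E\to E'$ of Lie $H$-pseudoalgebras with $\Theta\circ i=i'$ and $p'\circ\Theta=p$. **Non-abelian $2$-cocycles.** A non-abelian $2$-cocycle of $L$ with values in $M$ is a pair $(\chi,\psi)$ with $\chi\in\mathrm{Hom}_{H^{\otimes 2}}(L\otimes L,H^{\otimes 2}\otimes_H M)$ skew-symmetric and $\psi\in\mathrm{Hom}_{H^{\otimes 2}}(L\otimes M,H^{\otimes 2}\otimes_H M)$ such that for all $x,y,z\in L$, $u,v\in M$: 1. $[\psi(x,u)*v]_M=\psi(x,[u*v]_M)-(\sigma_{12}\otimes_H 1)[u*\psi(x,v)]_M$; 2. $\psi(x,\psi(y,u))-(\sigma_{12}\otimes_H 1)\psi(y,\psi(x,u))-\psi([x*y]_L,u)=[\chi(x,y)*u]_M$; 3. $\psi(x,\chi(y,z))-(\sigma_{12}\otimes_H 1)\psi(y,\chi(x,z))+(\sigma_{1\to 3}\otimes_H 1)\psi(z,\chi(x,y))+\chi(x,[y*z]_L)-(\sigma_{12}\otimes_H 1)\chi(y,[x*z]_L)+(\sigma_{1\to 3}\otimes_H 1)\chi(z,[x*y]_L)=0$. Two cocycles $(\chi,\psi)$, $(\chi',\psi')$ are equivalent if there is an $H$-linear map $\varphi:L\to M$ such that for all $x,y\in L$, $u\in M$: $\psi(x,u)-\psi'(x,u)=[\varphi(x)*u]_M$ and $\chi(x,y)-\chi'(x,y)=\psi'(x,\varphi(y))-(\sigma_{12}\otimes_H 1)\psi'(y,\varphi(x))-(\mathrm{id}_{H^{\otimes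 2}}\otimes_H\varphi)[x*y]_L+[\varphi(x)*\varphi(y)]_M$.
   Formalization: Only extensions whose sequence of H-modules splits (p has an H-linear section) are counted in Ext_nab(L,M); without this the claim fails, e.g. for H = k[x] with x primitive, L = M = k with x acting by 0 and zero brackets. *)

(* Defs.v *)
From HB Require Import structures.
From mathcomp Require Import all_boot all_order all_algebra.
From mathcomp Require Import boolp classical_sets.

Set Implicit Arguments.
Unset Strict Implicit.
Unset Printing Implicit Defensive.

Import GRing.Theory.
Local Open Scope ring_scope.
Local Open Scope quotient_scope.

Reserved Notation "U *t V" (at level 40, left associativity).
Reserved Notation "u @t v" (at level 45, left associativity).

Section BalancedTensor.
Variables (R : pzRingType) (X : zmodType) (ract : X -> R -> X) (Y : lmodType R).

(* A sequence of pairs (x_i, y_i) stands for the formal sum of the x_i (x) y_i,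
   where X is a right R-module through ract and Y is a left R-module.  No
   integer coefficients are needed since x (x) y has opposite (- x) (x) y. *)
Inductive tens_rel : seq (X * Y) -> seq (X * Y) -> Prop :=
| TensRefl s : tens_rel s s
| TensSym s t : tens_rel s t -> tens_rel t s
| TensTrans t s u : tens_rel s t -> tens_rel t u -> tens_rel s u
| TensCat s s' t t' :
    tens_rel s s' -> tens_rel t t' -> tens_rel (s ++ t) (s' ++ t')
| TensC s t : tens_rel (s ++ t) (t ++ s)
| Tens0 y : tens_rel [:: (0, y)] [::]
| TensDl x x' y : tens_rel [:: (x + x', y)] [:: (x, y); (x', y)]
| TensDr x y y' : tens_rel [:: (x, y + y')] [:: (x, y); (x, y')]
| TensA x a y : tens_rel [:: (ract x a, y)] [:: (x, a *: y)].

Definition tens_relb (s t : seq (X * Y)) : bool := `[< tens_rel s t >].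

Lemma tens_relb_refl : reflexive tens_relb.
Proof. by move=> s; apply/asboolP; exact: TensRefl. Qed.

Lemma tens_relb_sym : symmetric tens_relb.
Proof. by move=> s t; apply/asboolP/asboolP; exact: TensSym. Qed.

Lemma tens_relb_trans : transitive tens_relb.
Proof.
by move=> t s u /asboolP st /asboolP tu; apply/asboolP; exact: TensTrans tu.
Qed.

Canonical tens_equiv :=
  EquivRel tens_relb tens_relb_refl tens_relb_sym tens_relb_trans.

Definition tens := {eq_quot tens_equiv}.

HB.instance Definition _ := Choice.on tens.
HB.instance Definition _ := EqQuotient.on tens.

Lemma tens_eqP (s t : seq (X * Y)) :
  tens_rel s t <-> \pi_tens s = \pi_tens t.
Proof.
split=> [st|/eqmodP]; last by move/asboolP.
by apply/eqmodP; apply/asboolP.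
Qed.

Lemma tens_repr (s : seq (X * Y)) : tens_rel (repr (\pi_tens s)) s.
Proof. by apply/tens_eqP; rewrite reprK. Qed.

Definition pure (x : X) (y : Y) : tens := \pi_tens [:: (x, y)].

Definition tens_zero : tens := \pi_tens [::].
Definition tens_add (s t : tens) : tens := \pi_tens (repr s ++ repr t).
Definition tens_opp (t : tens) : tens :=
  \pi_tens [seq (- p.1, p.2) | p <- repr t].

Lemma tens_add_pi s t :
  tens_add (\pi_tens s) (\pi_tens t) = \pi_tens (s ++ t).
Proof. by apply/tens_eqP; apply: TensCat; exact: tens_repr. Qed.

Lemma tens_addA : associative tens_add.
Proof.
move=> s t u; rewrite -[s]reprK -[t]reprK -[u]reprK.
rewrite (tens_add_pi (repr t) (repr u)) (tens_add_pi (repr s) (repr t)).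
by rewrite (tens_add_pi (repr s)) (tens_add_pi (_ ++ _)) catA.
Qed.

Lemma tens_addC : commutative tens_add.
Proof. by move=> s t; apply/tens_eqP; exact: TensC. Qed.

Lemma tens_add0 : left_id tens_zero tens_add.
Proof. by move=> s; rewrite -[s]reprK tens_add_pi. Qed.

Lemma tens_addN : left_inverse tens_zero tens_opp tens_add.
Proof.
move=> t; rewrite -{2}[t]reprK /tens_opp tens_add_pi; apply/tens_eqP.
elim: (repr t) => [|[x y] s IHs] /=; first exact: TensRefl.
set s' := map _ s in IHs *.
apply: (TensTrans (t := [:: (- x, y); (x, y)] ++ (s' ++ s))).
  rewrite -[_ :: _]/([:: (- x, y)] ++ (s' ++ [:: (x, y)] ++ s)).
  rewrite -[X in tens_rel _ X]/([:: (- x, y)] ++ (([:: (x, y)] ++ s') ++ s)).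
  apply: TensCat; first exact: TensRefl.
  by rewrite catA; apply: TensCat; [exact: TensC | exact: TensRefl].
rewrite -[[::]]/([::] ++ [::] : seq (X * Y)); apply: TensCat => //.
apply: (TensTrans (TensSym (TensDl _ _ _))).
by rewrite addNr; exact: Tens0.
Qed.

HB.instance Definition _ :=
  GRing.isZmodule.Build tens tens_addA tens_addC tens_add0 tens_addN.

Lemma pureDl x x' y : pure (x + x') y = pure x y + pure x' y.
Proof.
rewrite [RHS]tens_add_pi; apply/tens_eqP; exact: TensDl.
Qed.

Lemma pureDr x y y' : pure x (y + y') = pure x y + pure x y'.
Proof.
rewrite [RHS]tens_add_pi; apply/tens_eqP; exact: TensDr.
Qed.

Lemma pureA x a y : pure (ract x a) y = pure x (a *: y).
Proof. by apply/tens_eqP; exact: TensA. Qed.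

Lemma tensE (t : tens) : t = \sum_(p <- repr t) pure p.1 p.2.
Proof.
rewrite -{1}[t]reprK; elim: (repr t) => [|[x y] s IHs].
  by rewrite big_nil.
by rewrite big_cons -IHs [RHS]tens_add_pi.
Qed.

Lemma tens_ind (P : tens -> Prop) :
  P 0 -> (forall s t, P s -> P t -> P (s + t)) ->
  (forall x y, P (pure x y)) -> forall t, P t.
Proof. by move=> P0 PD Pp t; rewrite (tensE t); apply: big_ind. Qed.

Section Lift.
Variable W : zmodType.

Definition balanced (f : X -> Y -> W) : Prop :=
  [/\ forall x x' y, f (x + x') y = f x y + f x' y,
      forall x y y', f x (y + y') = f x y + f x y'
    & forall x a y, f (ract x a) y = f x (a *: y)].

(* The map induced by f on the tensor product; computed on a chosen
   representative, and independent of it when f is balanced (tlift_pure). *)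
Definition tlift (f : X -> Y -> W) (t : tens) : W :=
  \sum_(p <- repr t) f p.1 p.2.

Lemma tlift_pi f s : balanced f ->
  tlift f (\pi_tens s) = \sum_(p <- s) f p.1 p.2.
Proof.
case=> fDl fDr fA; rewrite /tlift.
have f0 y : f 0 y = 0 by apply: (addrI (f 0 y)); rewrite -fDl !addr0.
suff E u v : tens_rel u v -> \sum_(p <- u) f p.1 p.2 = \sum_(p <- v) f p.1 p.2.
  by apply: E; exact: tens_repr.
elim=> {s u v} //.
- by move=> t s' u _ -> _ ->.
- by move=> s s' t t' _ e1 _ e2; rewrite !big_cat /= e1 e2.
- by move=> s t; rewrite !big_cat /= addrC.
- by move=> y; rewrite big_seq1 big_nil.
- by move=> x x' y; rewrite big_seq1 big_cons big_seq1 /=.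
- by move=> x y y'; rewrite big_seq1 big_cons big_seq1 /=.
- by move=> x a y; rewrite big_seq1 big_seq1 /=.
Qed.

Lemma tlift_pure f x y : balanced f -> tlift f (pure x y) = f x y.
Proof. by move=> bf; rewrite tlift_pi // big_seq1. Qed.

Lemma tliftD f : balanced f -> {morph tlift f : s t / s + t}.
Proof.
move=> bf s t; rewrite -[s]reprK -[t]reprK [X in tlift _ X]tens_add_pi.
by rewrite !tlift_pi // big_cat.
Qed.

Lemma tlift0 f : balanced f -> tlift f 0 = 0.
Proof.
by move=> bf; apply: (addrI (tlift f 0)); rewrite -tliftD // !addr0.
Qed.

End Lift.
End BalancedTensor.

Section TensorMap.
Variables (R : pzRingType).
Variables (X : zmodType) (ract : X -> R -> X) (Y : lmodType R).
Variables (R' : pzRingType).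
Variables (X' : zmodType) (ract' : X' -> R' -> X') (Y' : lmodType R').

Definition tmap (f : X -> X') (g : Y -> Y') : tens ract Y -> tens ract' Y' :=
  tlift (fun x y => pure ract' (f x) (g y)).

Definition tmap_ok (f : X -> X') (g : Y -> Y') : Prop :=
  balanced ract (fun x y => pure ract' (f x) (g y)).

Lemma tmap_pure f g x y : tmap_ok f g ->
  tmap f g (pure ract x y) = pure ract' (f x) (g y).
Proof. by move=> ok; rewrite /tmap tlift_pure. Qed.

Lemma tmapD f g : tmap_ok f g -> {morph tmap f g : s t / s + t}.
Proof. exact: tliftD. Qed.

Lemma tmap0 f g : tmap_ok f g -> tmap f g 0 = 0.
Proof. exact: tlift0. Qed.

End TensorMap.

Arguments tmap {R X ract Y R' X' ract' Y'} f g t.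

Section LinearMaps.
Variables (R : pzRingType) (U V W : lmodType R).

Lemma linD (f : U -> V) : linear f -> {morph f : s t / s + t}.
Proof. by move=> lf s t; have := lf 1 s t; rewrite !scale1r. Qed.

Lemma lin0 (f : U -> V) : linear f -> f 0 = 0.
Proof. by move=> lf; apply: (addrI (f 0)); rewrite -linD // !addr0. Qed.

Lemma linZ (f : U -> V) : linear f -> forall a, {morph f : s / a *: s}.
Proof. by move=> lf a s; have := lf a s 0; rewrite lin0 // !addr0. Qed.

Lemma lin_comp (g : V -> W) (f : U -> V) :
  linear g -> linear f -> linear (fun x => g (f x)).
Proof. by move=> lg lf a x y; rewrite lf lg. Qed.

End LinearMaps.

Lemma lin_comb (R : comPzRingType) (U V : lmodType R) (f g : U -> V) c :
  linear f -> linear g -> linear (fun t => c *: f t + g t).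
Proof.
move=> lf lg d x y; rewrite lf lg !scalerDr !scalerA [c * d]mulrC -!addrA.
by congr (_ + _); rewrite addrCA.
Qed.

Section FieldTensor.
Variables (k : fieldType) (U V : lmodType k).

Definition tensk := tens (fun (u : U) (a : k) => a *: u) V.
HB.instance Definition _ := GRing.Zmodule.on tensk.

Definition purek (u : U) (v : V) : tensk := pure _ u v.

Definition bilin (W : lmodType k) (f : U -> V -> W) : Prop :=
  (forall v, linear (f^~ v)) /\ (forall u, linear (f u)).

Lemma bilin_balanced (W : lmodType k) (f : U -> V -> W) :
  bilin f -> balanced (fun (u : U) (a : k) => a *: u) f.
Proof.
case=> fl fr; split=> [x x' y|x y y'|x a y].
- by have := fl y 1 x x'; rewrite !scale1r.
- by have := fr x 1 y y'; rewrite !scale1r.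
- have e0 : f 0 y = 0.
    have := fl y 1 0 0; rewrite !scale1r addr0 => e.
    by apply: (addrI (f 0 y)); rewrite -e addr0.
  have e1 : f x 0 = 0.
    have := fr x 1 0 0; rewrite !scale1r addr0 => e.
    by apply: (addrI (f x 0)); rewrite -e addr0.
  have := fl y a x 0; have := fr x a y 0.
  by rewrite !addr0 e0 e1 !addr0 => -> ->.
Qed.

Lemma purekDl u u' v : purek (u + u') v = purek u v + purek u' v.
Proof. exact: pureDl. Qed.
Lemma purekDr u v v' : purek u (v + v') = purek u v + purek u v'.
Proof. exact: pureDr. Qed.
Lemma purekA a u v : purek (a *: u) v = purek u (a *: v).
Proof. exact: (pureA (fun (u : U) (a : k) => a *: u)). Qed.

Lemma tensk_ind (P : tensk -> Prop) :
  P 0 -> (forall s t, P s -> P t -> P (s + t)) ->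
  (forall x y, P (purek x y)) -> forall t, P t.
Proof. exact: tens_ind. Qed.

Definition tensk_scale (a : k) : tensk -> tensk :=
  tlift (fun u v => purek (a *: u) v).

Lemma tensk_scale_balanced a :
  balanced (fun (u : U) (a : k) => a *: u) (fun u v => purek (a *: u) v).
Proof.
split=> [x x' y|x y y'|x b y].
- by rewrite scalerDr purekDl.
- by rewrite purekDr.
- by rewrite -purekA !scalerA mulrC.
Qed.

Lemma tensk_scale_pure a u v :
  tensk_scale a (purek u v) = purek (a *: u) v.
Proof. by apply: tlift_pure; exact: tensk_scale_balanced. Qed.

Lemma tensk_scaleDr a : {morph tensk_scale a : s t / s + t}.
Proof. by apply: tliftD; exact: tensk_scale_balanced. Qed.

Lemma tensk_scale0 a : tensk_scale a 0 = 0.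
Proof. by apply: tlift0; exact: tensk_scale_balanced. Qed.

Lemma tensk_scaleA a b t :
  tensk_scale a (tensk_scale b t) = tensk_scale (a * b) t.
Proof.
elim/tensk_ind: t => [|s t IHs IHt|u v].
- by rewrite !tensk_scale0.
- by rewrite !tensk_scaleDr IHs IHt.
- by rewrite !tensk_scale_pure scalerA.
Qed.

Lemma tensk_scale1 : left_id 1 tensk_scale.
Proof.
move=> t; elim/tensk_ind: t => [|s t IHs IHt|u v].
- by rewrite !tensk_scale0.
- by rewrite !tensk_scaleDr IHs IHt.
- by rewrite !tensk_scale_pure scale1r.
Qed.

Lemma tensk_scaleDl t : {morph tensk_scale^~ t : a b / a + b}.
Proof.
move=> a b; elim/tensk_ind: t => [|s t IHs IHt|u v].
- by rewrite !tensk_scale0 addr0.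
- by rewrite !tensk_scaleDr IHs IHt addrACA.
- by rewrite !tensk_scale_pure scalerDl purekDl.
Qed.

HB.instance Definition _ := GRing.Zmodule_isLmodule.Build k tensk
  tensk_scaleA tensk_scale1 tensk_scaleDr tensk_scaleDl.

Lemma purekZl a u v : purek (a *: u) v = a *: purek u v.
Proof. by rewrite -tensk_scale_pure. Qed.

Lemma purekZr a u v : purek u (a *: v) = a *: purek u v.
Proof. by rewrite -purekA purekZl. Qed.

End FieldTensor.

Notation "U *t V" := (tensk U V) : type_scope.
Notation "u @t v" := (purek u v) : ring_scope.

Section FieldTensorMaps.
Variable k : fieldType.

Definition liftk (U V W : lmodType k) (f : U -> V -> W) : U *t V -> W :=
  tlift f.

Lemma liftkE (U V W : lmodType k) (f : U -> V -> W) u v :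
  bilin f -> liftk f (u @t v) = f u v.
Proof. by move=> bf; apply: tlift_pure; exact: bilin_balanced. Qed.

Lemma liftk_linear (U V W : lmodType k) (f : U -> V -> W) :
  bilin f -> linear (liftk f).
Proof.
move=> bf a s t; have bb := bilin_balanced bf.
rewrite [LHS]tliftD //; congr (_ + _).
elim/tensk_ind: s => [|s t' IHs IHt|u v].
- by rewrite scaler0 [LHS]tlift0 // [liftk _ _]tlift0 // scaler0.
- rewrite scalerDr [LHS]tliftD // [liftk f (s + _)]tliftD // scalerDr.
  by congr (_ + _).
- rewrite -purekZl [LHS]liftkE // liftkE //.
  have e0 : f 0 v = 0.
    have := bf.1 v 1 0 0; rewrite !scale1r addr0 => e.
    by apply: (addrI (f 0 v)); rewrite -e addr0.
  by have := bf.1 v a u 0; rewrite !addr0 e0 addr0.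
Qed.

(* Two linear maps that agree on pure tensors are equal. *)
Lemma tensk_ext (U V W : lmodType k) (f g : U *t V -> W) :
  linear f -> linear g -> (forall u v, f (u @t v) = g (u @t v)) -> f =1 g.
Proof.
move=> lf lg fg.
have D (h : U *t V -> W) : linear h -> {morph h : s t / s + t}.
  by move=> lh s t; have := lh 1 s t; rewrite !scale1r.
have Z (h : U *t V -> W) : linear h -> h 0 = 0.
  by move=> lh; apply: (addrI (h 0)); rewrite -D // !addr0.
move=> t; elim/tensk_ind: t => [|s t IHs IHt|//].
  by rewrite !Z.
by rewrite !D // IHs IHt.
Qed.

Definition mapk (U U' V V' : lmodType k) (f : U -> U') (g : V -> V') :
    U *t V -> U' *t V' :=
  liftk (fun u v => f u @t g v).

Lemma mapk_bilin (U U' V V' : lmodType k) (f : U -> U') (g : V -> V') :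
  linear f -> linear g -> bilin (fun u v => f u @t g v).
Proof.
move=> lf lg; split=> [v a u u'|u a v v'] /=.
- by rewrite lf purekDl purekZl.
- by rewrite lg purekDr purekZr.
Qed.

Lemma mapkE (U U' V V' : lmodType k) (f : U -> U') (g : V -> V') u v :
  linear f -> linear g -> mapk f g (u @t v) = f u @t g v.
Proof. by move=> lf lg; rewrite /mapk liftkE //; exact: mapk_bilin. Qed.

Lemma mapk_linear (U U' V V' : lmodType k) (f : U -> U') (g : V -> V') :
  linear f -> linear g -> linear (mapk f g).
Proof. by move=> lf lg; apply: liftk_linear; exact: mapk_bilin. Qed.

Definition tswap (U V : lmodType k) : U *t V -> V *t U :=
  liftk (fun u v => v @t u).

Lemma tswap_bilin (U V : lmodType k) :
  bilin (fun (u : U) (v : V) => v @t u).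
Proof.
split=> [v a u u'|u a v v'] /=.
- by rewrite purekDr purekZr.
- by rewrite purekDl purekZl.
Qed.

Lemma tswapE (U V : lmodType k) (u : U) (v : V) : tswap (u @t v) = v @t u.
Proof. by rewrite /tswap liftkE //; exact: tswap_bilin. Qed.

Lemma tswap_linear (U V : lmodType k) : linear (@tswap U V).
Proof. by apply: liftk_linear; exact: tswap_bilin. Qed.

Definition tassoc (U V W : lmodType k) : (U *t V) *t W -> U *t (V *t W) :=
  liftk (fun t w => mapk id (fun v => v @t w) t).

Lemma purek_linearl (U V : lmodType k) (v : V) :
  linear (fun u : U => u @t v).
Proof. by move=> a u u'; rewrite purekDl purekZl. Qed.

Lemma purek_linearr (U V : lmodType k) (u : U) :
  linear (fun v : V => u @t v).
Proof. by move=> a u' v'; rewrite purekDr purekZr. Qed.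

Lemma id_linear (U : lmodType k) : linear (@id U).
Proof. by []. Qed.

Lemma tassoc_bilin (U V W : lmodType k) :
  bilin (fun (t : U *t V) (w : W) => mapk id (fun v => v @t w) t).
Proof.
split=> [w|t a w w'] /=.
  by apply: mapk_linear; [exact: id_linear | exact: purek_linearl].
move: t; apply: tensk_ext => /=.
- by apply: mapk_linear; [exact: id_linear | exact: purek_linearl].
- move=> b s t; do !rewrite mapk_linear //; try exact: purek_linearl.
  rewrite !scalerDr !scalerA mulrC -!addrA; congr (_ + _).
  by rewrite addrCA.
- move=> u v; do !rewrite mapkE //; try exact: purek_linearl.
  by rewrite purekDr purekZr purekDr purekZr.
Qed.

Lemma tassocE (U V W : lmodType k) (u : U) (v : V) (w : W) :
  tassoc ((u @t v) @t w) = u @t (v @t w).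
Proof.
rewrite /tassoc liftkE; last exact: tassoc_bilin.
by rewrite mapkE //; exact: purek_linearl.
Qed.

Lemma tassoc_linear (U V W : lmodType k) : linear (@tassoc U V W).
Proof. by apply: liftk_linear; exact: tassoc_bilin. Qed.

End FieldTensorMaps.

Section Nontrivial.
Variables (k : fieldType).
Local Open Scope classical_set_scope.

Lemma exists_functional (V : lmodType k) (e : V) : e != 0 ->
  exists f : V -> k, scalar f /\ f e = 1.
Proof.
move=> e0.
pose P (A : set V) :=
  (forall a u v, A u -> A v -> A (a *: u + v)) /\ ~ A e.
have [|A [PA Amax]] := @Zorn_bigcup V P.
  move=> F FP Ftot; split=> [a u v [B FB Bu] [C FC Cv]|[B FB Be]].
    have [BC|CB] := Ftot B C FB FC.
      by exists C => //; have [clC _] := FP _ FC; apply: clC => //; exact: BC.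
    by exists B => //; have [clB _] := FP _ FB; apply: clB => //; exact: CB.
  by have [_] := FP _ FB.
have [clA nAe] := PA.
have A0 : A 0.
  apply: contrapT => nA0.
  have : P (A `|` [set 0]).
    split=> [a u v|]; last by case=> //= e_0; rewrite e_0 eqxx in e0.
    case=> [Au|/= ->] [Av|/= ->].
    - by left; apply: clA.
    - left; rewrite addr0.
      case: nA0; have := clA (-1) u u Au Au.
      by rewrite scaleN1r addNr.
    - by left; rewrite scaler0 add0r.
    - by right; rewrite scaler0 addr0.
  apply: Amax; split; first by move=> x; left.
  by move=> /(_ 0) h; apply: nA0; apply: h; right.
have AZ a u : A u -> A (a *: u) by move=> Au; rewrite -[_ *: _]addr0; exact: clA.
have AD u v : A u -> A v -> A (u + v).
  by move=> Au Av; rewrite -[u]scale1r; exact: clA.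
have AB u v : A u -> A v -> A (u - v).
  by move=> Au Av; apply: AD => //; rewrite -scaleN1r; exact: AZ.
have ex v : exists c, A (v - c *: e).
  have [|nAv] := pselect (A v); first by exists 0; rewrite scale0r subr0.
  pose B := [set w | exists c u, A u /\ w = u + c *: v].
  have nPB : ~ P B.
    apply: Amax; split.
      by move=> x Ax; exists 0, x; rewrite scale0r addr0.
    by move=> /(_ v) h; apply/nAv/h; exists 1, 0; rewrite scale1r add0r.
  have [[c [u [Au eE]]]|nBe] := pselect (B e); last first.
    case: nPB; split=> // a _ _ [c [u [Au ->]]] [d [w [Aw ->]]].
    exists (a * c + d), (a *: u + w); split; first exact: clA.
    by rewrite scalerDr scalerDl scalerA addrACA.
  have c0 : c != 0.
    by apply: contra_notN nAe => /eqP c0; rewrite eE c0 scale0r addr0.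
  exists c^-1; rewrite eE scalerDr scalerA mulVf // scale1r.
  by rewrite opprD addrCA subrr addr0 -scaleN1r; exact: AZ (AZ _ _ Au).
have uniq v c d : A (v - c *: e) -> A (v - d *: e) -> c = d.
  move=> h1 h2; apply/eqP; rewrite -subr_eq0; apply: contra_notT nAe => cd.
  have := AZ (c - d)^-1 _ (AB _ _ h2 h1).
  have -> : v - d *: e - (v - c *: e) = (c - d) *: e.
    by rewrite opprB addrC -addrA addKr scalerBl.
  by rewrite scalerA mulVf // scale1r.
pose f v := projT1 (cid (ex v)).
have fP v : A (v - f v *: e) by rewrite /f; case: cid.
exists f; split=> [a u v|].
  apply: (uniq (a *: u + v)) => //.
  rewrite /= scalerDl -scalerA opprD addrACA -scalerBr.
  exact: clA.
by apply: (uniq e) => //; rewrite scale1r subrr.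
Qed.

Lemma purek_neq0 (U V : lmodType k) (u : U) (v : V) :
  u != 0 -> v != 0 -> u @t v != 0.
Proof.
move=> /exists_functional[f [lf fu]] /exists_functional[g [lg gv]].
have bfg : bilin (fun u v => f u * g v : k^o).
  split=> [y a x x'|x a y y'] /=.
    by rewrite lf mulrDl -mulrA.
  by rewrite lg mulrDr mulrCA.
apply/eqP => uv0; have := liftkE u v bfg.
rewrite uv0 fu gv [LHS]tlift0; last exact: bilin_balanced.
by move/esym/eqP; rewrite mulr1 oner_eq0.
Qed.

End Nontrivial.

Section AlgTensor.
Variables (k : fieldType) (A B : algType k).
Local Notation T := (A *t B).

Definition tensk_mul (s t : T) : T :=
  liftk (fun a b => mapk ( *%R a) ( *%R b) t) s.

Let mull (C : algType k) (a : C) : linear ( *%R a).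
Proof. by move=> c x y; rewrite mulrDr scalerAr. Qed.

Let mapmE a b a' b' :
  mapk ( *%R a) ( *%R b) (a' @t b') = a * a' @t b * b' :> T.
Proof. by apply: mapkE; exact: mull. Qed.

Let mapm_linear a b : linear (mapk ( *%R a) ( *%R b) : T -> T).
Proof. by apply: mapk_linear; exact: mull. Qed.

Lemma tensk_mul_bilin t : bilin (fun a b => mapk ( *%R a) ( *%R b) t : T).
Proof.
have cmb (f g : T -> T) c : linear f -> linear g ->
    linear (fun t => c *: f t + g t).
  move=> lf lg d x y; rewrite lf lg !scalerDr !scalerA [c * d]mulrC -!addrA.
  by congr (_ + _); rewrite addrCA.
split=> [b c a a'|a c b b'] /=.
- move: t; apply: tensk_ext => /=; [exact: mapm_linear | exact: cmb |].
  by move=> x y; rewrite !mapmE mulrDl -scalerAl purekDl purekZl.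
- move: t; apply: tensk_ext => /=; [exact: mapm_linear | exact: cmb |].
  by move=> x y; rewrite !mapmE mulrDl -scalerAl purekDr purekZr.
Qed.

Lemma tensk_mul_linearl t : linear (tensk_mul^~ t).
Proof. by apply: liftk_linear; exact: tensk_mul_bilin. Qed.

Lemma tensk_mul_pure a b t :
  tensk_mul (a @t b) t = mapk ( *%R a) ( *%R b) t.
Proof. by rewrite /tensk_mul liftkE //; exact: tensk_mul_bilin. Qed.

Lemma tensk_mul_linearr s : linear (tensk_mul s).
Proof.
move=> c x y; move: s; apply: tensk_ext.
- exact: tensk_mul_linearl.
- move=> d s t; rewrite !tensk_mul_linearl !scalerDr !scalerA [c * d]mulrC.
  by rewrite -!addrA; congr (_ + _); rewrite addrCA.
- by move=> a b; rewrite !tensk_mul_pure mapm_linear.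
Qed.

Lemma tensk_mulE a b a' b' :
  tensk_mul (a @t b) (a' @t b') = (a * a') @t (b * b').
Proof. by rewrite tensk_mul_pure mapmE. Qed.

Lemma tensk_mulDl : left_distributive tensk_mul +%R.
Proof.
by move=> x y t; have := tensk_mul_linearl t 1 x y; rewrite !scale1r.
Qed.

Lemma tensk_mulDr : right_distributive tensk_mul +%R.
Proof.
by move=> t x y; have := tensk_mul_linearr t 1 x y; rewrite !scale1r.
Qed.

Lemma tensk_mul0l t : tensk_mul 0 t = 0.
Proof.
by apply: (addrI (tensk_mul 0 t)); rewrite -tensk_mulDl !addr0.
Qed.

Lemma tensk_mul0r t : tensk_mul t 0 = 0.
Proof.
by apply: (addrI (tensk_mul t 0)); rewrite -tensk_mulDr !addr0.
Qed.

Lemma tensk_mulA : associative tensk_mul.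
Proof.
move=> x y z.
elim/tensk_ind: x => [|x x' IHx IHx'|a b]; rewrite ?tensk_mul0l //.
  by rewrite !tensk_mulDl IHx IHx'.
elim/tensk_ind: y => [|y y' IHy IHy'|a' b'].
- by rewrite !(tensk_mul0l, tensk_mul0r).
- by rewrite !(tensk_mulDl, tensk_mulDr) IHy IHy'.
elim/tensk_ind: z => [|z z' IHz IHz'|a'' b''].
- by rewrite !tensk_mul0r.
- by rewrite !tensk_mulDr IHz IHz'.
- by rewrite !tensk_mulE !mulrA.
Qed.

Lemma tensk_mul1l : left_id (1 @t 1) tensk_mul.
Proof.
move=> x; elim/tensk_ind: x => [|x x' IHx IHx'|a b].
- by rewrite tensk_mul0r.
- by rewrite tensk_mulDr IHx IHx'.
- by rewrite tensk_mulE !mul1r.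
Qed.

Lemma tensk_mul1r : right_id (1 @t 1) tensk_mul.
Proof.
move=> x; elim/tensk_ind: x => [|x x' IHx IHx'|a b].
- by rewrite tensk_mul0l.
- by rewrite tensk_mulDl IHx IHx'.
- by rewrite tensk_mulE !mulr1.
Qed.

Lemma tensk_1neq0 : (1 @t 1 : T) != 0.
Proof. by apply: purek_neq0; exact: oner_neq0. Qed.

HB.instance Definition _ := GRing.Zmodule_isNzRing.Build T
  tensk_mulA tensk_mul1l tensk_mul1r tensk_mulDl tensk_mulDr tensk_1neq0.

Lemma tensk_scalerAl (c : k) (x y : T) : c *: (x * y) = (c *: x) * y.
Proof.
have /= := tensk_mul_linearl y c x 0.
by rewrite !addr0 tensk_mul0l addr0 => <-.
Qed.

Lemma tensk_scalerAr (c : k) (x y : T) : c *: (x * y) = x * (c *: y).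
Proof.
have /= := tensk_mul_linearr x c y 0.
by rewrite !addr0 tensk_mul0r addr0 => <-.
Qed.

HB.instance Definition _ :=
  GRing.LSemiModule_isLSemiAlgebra.Build k T tensk_scalerAl.
HB.instance Definition _ :=
  GRing.LSemiAlgebra_isSemiAlgebra.Build k T tensk_scalerAr.

Lemma purekM (a a' : A) (b b' : B) :
  (a @t b) * (a' @t b') = (a * a') @t (b * b').
Proof. exact: tensk_mulE. Qed.

End AlgTensor.

Section Multiplicative.
Variables (k : fieldType) (D : algType k).

Lemma tensk_morphM (A B : algType k) (f : A *t B -> D) : linear f ->
  (forall a b a' b', f ((a @t b) * (a' @t b')) = f (a @t b) * f (a' @t b')) ->
  {morph f : s t / s * t}.
Proof.
move=> lf fM s t; have [fD f0] := (linD lf, lin0 lf).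
elim/tensk_ind: s => [|s s' IH IH'|a b]; first by rewrite mul0r f0 mul0r.
  by rewrite mulrDl !fD IH IH' mulrDl.
elim/tensk_ind: t => [|t t' IH IH'|a' b']; first by rewrite mulr0 f0 mulr0.
  by rewrite mulrDr !fD IH IH' mulrDr.
exact: fM.
Qed.

Lemma tensk3l_morphM (A B C : algType k) (f : (A *t B) *t C -> D) : linear f ->
  (forall a b c a' b' c', f (((a @t b) @t c) * ((a' @t b') @t c')) =
     f ((a @t b) @t c) * f ((a' @t b') @t c')) ->
  {morph f : s t / s * t}.
Proof.
move=> lf fM; apply: tensk_morphM => // u c u' c'.
have fcD (d : C) : {morph (fun v : A *t B => f (v @t d)) : v v' / v + v'}.
  by move=> v v' /=; rewrite purekDl linD.
have fc0 (d : C) : f ((0 : A *t B) @t d) = 0.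
  by apply: (addrI (f (0 @t d))); rewrite -fcD !addr0.
rewrite purekM.
elim/tensk_ind: u => [|s s' IH IH'|a b]; first by rewrite mul0r !fc0 mul0r.
  by rewrite mulrDl !fcD IH IH' mulrDl.
elim/tensk_ind: u' => [|t t' IH IH'|a' b']; first by rewrite mulr0 !fc0 mulr0.
  by rewrite mulrDr !fcD IH IH' mulrDr.
by rewrite -fM [in RHS]purekM.
Qed.

Lemma tensk3r_morphM (A B C : algType k) (f : A *t (B *t C) -> D) : linear f ->
  (forall a b c a' b' c', f ((a @t (b @t c)) * (a' @t (b' @t c'))) =
     f (a @t (b @t c)) * f (a' @t (b' @t c'))) ->
  {morph f : s t / s * t}.
Proof.
move=> lf fM; apply: tensk_morphM => // a u a' u'.
have fcD (d : A) : {morph (fun v : B *t C => f (d @t v)) : v v' / v + v'}.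
  by move=> v v' /=; rewrite purekDr linD.
have fc0 (d : A) : f (d @t (0 : B *t C)) = 0.
  by apply: (addrI (f (d @t 0))); rewrite -fcD !addr0.
rewrite purekM.
elim/tensk_ind: u => [|s s' IH IH'|b c]; first by rewrite mul0r !fc0 mul0r.
  by rewrite mulrDl !fcD IH IH' mulrDl.
elim/tensk_ind: u' => [|t t' IH IH'|b' c']; first by rewrite mulr0 !fc0 mulr0.
  by rewrite mulrDr !fcD IH IH' mulrDr.
by rewrite -fM [in RHS]purekM.
Qed.

Lemma mull_linear (c : D) : linear ( *%R c).
Proof. by move=> a x y; rewrite mulrDr scalerAr. Qed.

Lemma mulr_linear (c : D) : linear ( *%R^~ c).
Proof. by move=> a x y; rewrite mulrDl scalerAl. Qed.

Lemma lin_mull (U : lmodType k) (c : D) (f : U -> D) :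
  linear f -> linear (fun x => c * f x).
Proof. exact: lin_comp (mull_linear c). Qed.

Lemma lin_mulr (U : lmodType k) (c : D) (f : U -> D) :
  linear f -> linear (fun x => f x * c).
Proof. exact: lin_comp (mulr_linear c). Qed.

Lemma lin_cmull (U : lmodType k) (c : D) (f : D -> U) :
  linear f -> linear (fun x => f (c * x)).
Proof. by move=> lf; apply: lin_comp lf (mull_linear c). Qed.

Lemma lin_cmulr (U : lmodType k) (c : D) (f : D -> U) :
  linear f -> linear (fun x => f (x * c)).
Proof. by move=> lf; apply: lin_comp lf (mulr_linear c). Qed.

End Multiplicative.

HB.mixin Record isCocommHopfAlgebra (k : fieldType) H of GRing.Algebra k H := {
  comult : {lrmorphism H -> H *t H};
  counit : {lrmorphism H -> k^o};
  antipode : {linear H -> H};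
  comultA : forall h : H,
    tassoc (mapk comult id (comult h)) = mapk id comult (comult h);
  counitl : forall h : H, liftk (fun a b => counit a *: b) (comult h) = h;
  counitr : forall h : H, liftk (fun a b => counit b *: a) (comult h) = h;
  antipodel : forall h : H,
    liftk (fun a b => antipode a * b) (comult h) = (counit h)%:A;
  antipoder : forall h : H,
    liftk (fun a b => a * antipode b) (comult h) = (counit h)%:A;
  comultC : forall h : H, tswap (comult h) = comult h
}.

#[short(type="cocommHopfAlgType")]
HB.structure Definition CocommHopfAlgebra (k : fieldType) :=
  { H of isCocommHopfAlgebra k H & GRing.Algebra k H }.

Section PseudoTensor.
Variables (k : fieldType) (H : cocommHopfAlgType k).
Local Notation H2 := (H *t H).
Local Notation H3 := (H *t (H *t H)).

Definition comult3 (h : H) : H3 := mapk id comult (comult h).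

Definition ract2 (t : H2) (h : H) : H2 := t * comult h.
Definition ract3 (t : H3) (h : H) : H3 := t * comult3 h.

Definition pst2 (Z : lmodType H) := tens ract2 Z.
Definition pst3 (Z : lmodType H) := tens ract3 Z.
HB.instance Definition _ Z := GRing.Zmodule.on (pst2 Z).
HB.instance Definition _ Z := GRing.Zmodule.on (pst3 Z).

Definition pure2 (Z : lmodType H) (t : H2) (z : Z) : pst2 Z := pure ract2 t z.
Definition pure3 (Z : lmodType H) (t : H3) (z : Z) : pst3 Z := pure ract3 t z.

(* The action of t in H^(x)2 on H^(x)2 (x)_H Z. *)
Definition lact2 (Z : lmodType H) (t : H2) : pst2 Z -> pst2 Z :=
  tmap ( *%R t) id.

(* id (x)_H f *)
Definition pstmap2 (Z Z' : lmodType H) (f : Z -> Z') : pst2 Z -> pst2 Z' :=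
  tmap id f.

Definition perm12 (t : H3) : H3 :=
  liftk (fun a bc => liftk (fun b c => b @t (a @t c)) bc) t.
(* Sends h3 (x) h1 (x) h2 to h1 (x) h2 (x) h3. *)
Definition perm13 (t : H3) : H3 :=
  liftk (fun a bc => liftk (fun b c => b @t (c @t a)) bc) t.

Definition sigma2 (Z : lmodType H) : pst2 Z -> pst2 Z :=
  tmap (@tswap k H H) id.
Definition sigma12 (Z : lmodType H) : pst3 Z -> pst3 Z := tmap perm12 id.
Definition sigma13 (Z : lmodType H) : pst3 Z -> pst3 Z := tmap perm13 id.

Lemma equivar_tmap_ok (R : pzRingType)
    (X : zmodType) (ract : X -> R -> X) (Y : lmodType R)
    (X' : zmodType) (ract' : X' -> R -> X') (Y' : lmodType R)
    (f : X -> X') (g : Y -> Y') :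
  {morph f : x y / x + y} -> linear g ->
  (forall x a, f (ract x a) = ract' (f x) a) -> tmap_ok ract ract' f g.
Proof.
move=> fD lg fA; have [gD gZ] := (linD lg, linZ lg).
split=> [x x' y|x y y'|x a y].
- by rewrite fD pureDl.
- by rewrite gD pureDr.
- by rewrite fA pureA gZ.
Qed.

Lemma tens3_ind (P : H3 -> Prop) :
  P 0 -> (forall s t, P s -> P t -> P (s + t)) ->
  (forall a b c, P (a @t (b @t c))) -> forall t, P t.
Proof.
move=> P0 PD Pp; elim/tensk_ind => // a t; move: t a.
elim/tensk_ind => [|s t IHs IHt|b c] a //.
- suff -> : a @t (0 : H2) = 0 by [].
  by apply: (addrI (a @t 0)); rewrite -purekDr !addr0.
- by rewrite purekDr; apply: PD.
Qed.

Lemma perm12_inner (a : H) :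
  bilin (fun b c : H => b @t (a @t c) : H3).
Proof.
split=> [c d b b'|b d c c'] /=; first by rewrite purekDl purekZl.
by rewrite purekDr purekZr purekDr purekZr.
Qed.

Lemma perm13_inner (a : H) :
  bilin (fun b c : H => b @t (c @t a) : H3).
Proof.
split=> [c d b b'|b d c c'] /=; first by rewrite purekDl purekZl.
by rewrite purekDl purekZl purekDr purekZr.
Qed.

Lemma perm12_bilin :
  bilin (fun (a : H) (bc : H2) => liftk (fun b c => b @t (a @t c) : H3) bc).
Proof.
split=> [bc d a a'|a] /=; last exact: liftk_linear (perm12_inner a).
move: bc; apply: tensk_ext.
- exact: liftk_linear (perm12_inner _).
- by apply: lin_comb; apply: liftk_linear; exact: perm12_inner.
- move=> b c; rewrite !liftkE; try exact: perm12_inner.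
  by rewrite purekDl purekZl purekDr purekZr.
Qed.

Lemma perm13_bilin :
  bilin (fun (a : H) (bc : H2) => liftk (fun b c => b @t (c @t a) : H3) bc).
Proof.
split=> [bc d a a'|a] /=; last exact: liftk_linear (perm13_inner a).
move: bc; apply: tensk_ext.
- exact: liftk_linear (perm13_inner _).
- by apply: lin_comb; apply: liftk_linear; exact: perm13_inner.
- move=> b c; rewrite !liftkE; try exact: perm13_inner.
  by rewrite purekDr purekZr purekDr purekZr.
Qed.

Lemma perm12E a b c : perm12 (a @t (b @t c)) = b @t (a @t c).
Proof.
by rewrite /perm12 liftkE ?liftkE //; [exact: perm12_inner|exact: perm12_bilin].
Qed.

Lemma perm13E a b c : perm13 (a @t (b @t c)) = b @t (c @t a).
Proof.
by rewrite /perm13 liftkE ?liftkE //; [exact: perm13_inner|exact: perm13_bilin].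
Qed.

Lemma perm12_linear : linear perm12.
Proof. exact: liftk_linear perm12_bilin. Qed.

Lemma perm13_linear : linear perm13.
Proof. exact: liftk_linear perm13_bilin. Qed.

Lemma perm12M : {morph perm12 : s t / s * t}.
Proof.
apply: tensk3r_morphM; first exact: perm12_linear.
by move=> a b c a' b' c'; rewrite !purekM !perm12E !purekM.
Qed.

Lemma perm13M : {morph perm13 : s t / s * t}.
Proof.
apply: tensk3r_morphM; first exact: perm13_linear.
by move=> a b c a' b' c'; rewrite !purekM !perm13E !purekM.
Qed.

Lemma tswapM : {morph @tswap k H H : s t / s * t}.
Proof.
apply: tensk_morphM; first exact: tswap_linear.
by move=> a b a' b'; rewrite !purekM !tswapE !purekM.
Qed.

Lemma idcomult_linear : linear (mapk id comult : H2 -> H3).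
Proof. by apply: mapk_linear; [exact: id_linear | exact: linearP]. Qed.

Lemma comult3_perm12 (h : H) : perm12 (comult3 h) = comult3 h.
Proof.
rewrite /comult3 -comultA; move: (comult h) => t.
have lL : linear (fun t : H2 => tassoc (mapk comult id t) : H3).
  apply: lin_comp; first exact: tassoc_linear.
  by apply: mapk_linear; [exact: linearP | exact: id_linear].
move: t; apply: tensk_ext => //.
  by apply: lin_comp => //; exact: perm12_linear.
move=> a b; rewrite mapkE; [|exact: linearP|exact: id_linear].
rewrite -{2}(comultC a); move: (comult a); apply: tensk_ext.
- apply: lin_comp; first exact: perm12_linear.
  apply: lin_comp; first exact: tassoc_linear.
  exact: purek_linearl.
- apply: lin_comp; first exact: tassoc_linear.
  apply: (@lin_comp _ _ _ _ (fun t => t @t b)); first exact: purek_linearl.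
  exact: tswap_linear.
- by move=> c d; rewrite tswapE !tassocE perm12E.
Qed.

Lemma comult3_perm13 (h : H) : perm13 (comult3 h) = comult3 h.
Proof.
have lS : linear (mapk id (@tswap k H H) : H3 -> H3).
  by apply: mapk_linear; [exact: id_linear | exact: tswap_linear].
have -> : perm13 (comult3 h) = mapk id (@tswap k H H) (perm12 (comult3 h)).
  move: (comult3 h); elim/tens3_ind => [|s t IHs IHt|a b c].
  - by rewrite (lin0 perm13_linear) (lin0 perm12_linear) (lin0 lS).
  - by rewrite (linD perm13_linear) (linD perm12_linear) (linD lS) IHs IHt.
  - rewrite perm12E perm13E mapkE ?tswapE //; exact: tswap_linear.
rewrite comult3_perm12 /comult3.
move: (comult h); apply: tensk_ext.
- by apply: lin_comp => //; exact: idcomult_linear.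
- exact: idcomult_linear.
- move=> a b; rewrite mapkE; [|exact: id_linear|exact: linearP].
  by rewrite mapkE; [rewrite comultC|exact: id_linear|exact: tswap_linear].
Qed.

Lemma lact2_ok (Z : lmodType H) (t : H2) :
  tmap_ok ract2 ract2 ( *%R t) (@id Z).
Proof.
apply: equivar_tmap_ok => // [x y|x a]; first exact: mulrDr.
exact: mulrA.
Qed.

Lemma lact2D (Z : lmodType H) (t : H2) : {morph @lact2 Z t : v w / v + w}.
Proof. by apply: tmapD; exact: lact2_ok. Qed.

Lemma lact2_0 (Z : lmodType H) (t : H2) : @lact2 Z t 0 = 0.
Proof. by apply: tmap0; exact: lact2_ok. Qed.

Lemma lact2_pure (Z : lmodType H) (t s : H2) (z : Z) :
  lact2 t (pure2 s z) = pure2 (t * s) z.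
Proof.
by apply: tmap_pure; exact: lact2_ok.
Qed.

Lemma pstmap2_pure (Z Z' : lmodType H) (f : {linear Z -> Z'}) (t : H2) (z : Z) :
  pstmap2 f (pure2 t z) = pure2 t (f z).
Proof. by apply: tmap_pure; apply: equivar_tmap_ok => //; exact: linearP. Qed.

Lemma sigma2_pure (Z : lmodType H) (t : H2) (z : Z) :
  sigma2 (pure2 t z) = pure2 (tswap t) z.
Proof.
apply: tmap_pure; apply: equivar_tmap_ok => // [|x a].
  exact: linD (@tswap_linear _ _ _).
by rewrite /ract2 tswapM comultC.
Qed.

Lemma sigma12_pure (Z : lmodType H) (t : H3) (z : Z) :
  sigma12 (pure3 t z) = pure3 (perm12 t) z.
Proof.
apply: tmap_pure; apply: equivar_tmap_ok => // [|x a].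
  exact: linD perm12_linear.
by rewrite /ract3 perm12M comult3_perm12.
Qed.

Lemma sigma13_pure (Z : lmodType H) (t : H3) (z : Z) :
  sigma13 (pure3 t z) = pure3 (perm13 t) z.
Proof.
apply: tmap_pure; apply: equivar_tmap_ok => // [|x a].
  exact: linD perm13_linear.
by rewrite /ract3 perm13M comult3_perm13.
Qed.

(* The ground field acts on H-modules through H, so biadditivity together with
   the last clause gives k-bilinearity, i.e. a k-linear map on X (x)_k Y. *)
Definition pseudolinear (X Y Z : lmodType H) (A : X -> Y -> pst2 Z) : Prop :=
  [/\ forall x x' y, A (x + x') y = A x y + A x' y,
      forall x y y', A x (y + y') = A x y + A x y'
    & forall (f g : H) x y, A (f *: x) (g *: y) = lact2 (f @t g) (A x y)].

Definition skew (X Z : lmodType H) (A : X -> X -> pst2 Z) : Prop :=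
  forall x y, A y x = - sigma2 (A x y).

(* (f (x) g) and (f' (x) g') give f f'_(1) (x) g f'_(2) (x) g'. *)
Definition insl (fg : H2) (t : H2) : H3 :=
  tassoc (mapk (fun f' : H => fg * comult f') id t).
(* (h (x) l) and (h' (x) l') give h' (x) h l'_(1) (x) l l'_(2). *)
Definition insr (hl : H2) (t : H2) : H3 :=
  mapk id (fun l' : H => hl * comult l') t.

(* A(w, z) for w in H^(x)2 (x)_H X, and A(x, w) for w in H^(x)2 (x)_H Y; see
   compl_pure and compr_pure for the formulas on pure tensors. *)
Definition compl (X Y Z : lmodType H) (A : X -> Y -> pst2 Z)
    (w : pst2 X) (z : Y) : pst3 Z :=
  tlift (fun fg e => tmap (insl fg) id (A e z)) w.

Definition compr (X Y Z : lmodType H) (A : X -> Y -> pst2 Z)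
    (x : X) (w : pst2 Y) : pst3 Z :=
  tlift (fun hl d => tmap (insr hl) id (A x d)) w.

Lemma mulcomult_linear (t : H2) : linear (fun f : H => t * comult f : H2).
Proof. by move=> a x y; rewrite linearP mulrDr scalerAr. Qed.

Lemma insl_linear (fg : H2) : linear (insl fg).
Proof.
apply: (lin_comp (@tassoc_linear _ _ _ _)).
by apply: mapk_linear; [exact: mulcomult_linear | exact: id_linear].
Qed.

Lemma insr_linear (hl : H2) : linear (insr hl).
Proof. by apply: mapk_linear; [exact: id_linear | exact: mulcomult_linear]. Qed.

Lemma insl_pure (fg : H2) (f' g' : H) :
  insl fg (f' @t g') = tassoc ((fg * comult f') @t g').
Proof.
by rewrite /insl mapkE //; exact: mulcomult_linear.
Qed.

Lemma insr_pure (hl : H2) (h' l' : H) :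
  insr hl (h' @t l') = h' @t (hl * comult l').
Proof. by rewrite /insr mapkE //; exact: mulcomult_linear. Qed.

Lemma tassocM : {morph @tassoc k H H H : s t / s * t}.
Proof.
apply: tensk3l_morphM; first exact: tassoc_linear.
by move=> a b c a' b' c'; rewrite !purekM !tassocE !purekM.
Qed.

Lemma insl_ract (fg t : H2) (h : H) :
  insl fg (ract2 t h) = ract3 (insl fg t) h.
Proof.
rewrite /ract2 /ract3 /comult3 -comultA.
have lM : linear (mapk (comult : H -> H2) id : H2 -> H2 *t H).
  by apply: mapk_linear; [exact: linearP | exact: id_linear].
move: t; apply: tensk_ext.
- by apply: lin_cmulr; exact: insl_linear.
- by apply: lin_mulr; exact: insl_linear.
move=> f g; rewrite insl_pure; move: (comult h); apply: tensk_ext.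
- by apply: lin_cmull; exact: insl_linear.
- by apply: lin_mull; exact: lin_comp (@tassoc_linear _ _ _ _) lM.
move=> a b; rewrite purekM insl_pure mapkE //; last exact: linearP.
by rewrite -tassocM purekM rmorphM mulrA.
Qed.

Lemma insr_ract (hl t : H2) (h : H) :
  insr hl (ract2 t h) = ract3 (insr hl t) h.
Proof.
rewrite /ract2 /ract3 /comult3.
move: t; apply: tensk_ext.
- by apply: lin_cmulr; exact: insr_linear.
- by apply: lin_mulr; exact: insr_linear.
move=> f g; rewrite insr_pure; move: (comult h); apply: tensk_ext.
- by apply: lin_cmull; exact: insr_linear.
- by apply: lin_mull; exact: idcomult_linear.
move=> a b; rewrite purekM insr_pure mapkE //; last exact: linearP.
by rewrite purekM rmorphM mulrA.
Qed.

Lemma insl_ok (Z : lmodType H) (fg : H2) :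
  tmap_ok ract2 ract3 (insl fg) (@id Z).
Proof.
by apply: equivar_tmap_ok => //; [exact: linD (insl_linear _) | exact: insl_ract].
Qed.

Lemma insr_ok (Z : lmodType H) (hl : H2) :
  tmap_ok ract2 ract3 (insr hl) (@id Z).
Proof.
by apply: equivar_tmap_ok => //; [exact: linD (insr_linear _) | exact: insr_ract].
Qed.

Lemma insl_lact2 (Z : lmodType H) (t : H2) (h : H) (w : pst2 Z) :
  tmap (insl t) id (lact2 (h @t 1) w)
    = tmap (insl (t * comult h)) id w :> pst3 Z.
Proof.
elim/tens_ind: w => [|w w' IH IH'|s z].
- by rewrite lact2_0 !tmap0 //; exact: insl_ok.
- by rewrite lact2D !tmapD ?IH ?IH' //; exact: insl_ok.
- rewrite [lact2 _ _]lact2_pure !tmap_pure; try exact: insl_ok.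
  congr (pure _ _ _); move: s; apply: tensk_ext.
  + by apply: lin_cmull; exact: insl_linear.
  + exact: insl_linear.
  + by move=> f g; rewrite purekM !insl_pure mul1r rmorphM mulrA.
Qed.

Lemma insr_lact2 (Z : lmodType H) (t : H2) (h : H) (w : pst2 Z) :
  tmap (insr t) id (lact2 (1 @t h) w)
    = tmap (insr (t * comult h)) id w :> pst3 Z.
Proof.
elim/tens_ind: w => [|w w' IH IH'|s z].
- by rewrite lact2_0 !tmap0 //; exact: insr_ok.
- by rewrite lact2D !tmapD ?IH ?IH' //; exact: insr_ok.
- rewrite [lact2 _ _]lact2_pure !tmap_pure; try exact: insr_ok.
  congr (pure _ _ _); move: s; apply: tensk_ext.
  + by apply: lin_cmull; exact: insr_linear.
  + exact: insr_linear.
  + by move=> f g; rewrite purekM !insr_pure mul1r rmorphM mulrA.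
Qed.

Lemma tmap_inslDl (Z : lmodType H) (t t' : H2) (w : pst2 Z) :
  tmap (insl (t + t')) id w = tmap (insl t) id w + tmap (insl t') id w :> pst3 Z.
Proof.
elim/tens_ind: w => [|w w' IH IH'|s z].
- by rewrite !tmap0 ?addr0 //; exact: insl_ok.
- by rewrite !tmapD ?IH ?IH' 1?addrACA //; exact: insl_ok.
- rewrite !tmap_pure; try exact: insl_ok.
  rewrite -[RHS]pureDl; congr (pure _ _ _).
  elim/tensk_ind: s => [|s s' IH IH'|f g].
  + by rewrite !(lin0 (insl_linear _)) addr0.
  + by rewrite !(linD (insl_linear _)) IH IH' addrACA.
  + by rewrite !insl_pure mulrDl purekDl (linD (@tassoc_linear _ _ _ _)).
Qed.

Lemma tmap_insrDl (Z : lmodType H) (t t' : H2) (w : pst2 Z) :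
  tmap (insr (t + t')) id w = tmap (insr t) id w + tmap (insr t') id w :> pst3 Z.
Proof.
elim/tens_ind: w => [|w w' IH IH'|s z].
- by rewrite !tmap0 ?addr0 //; exact: insr_ok.
- by rewrite !tmapD ?IH ?IH' 1?addrACA //; exact: insr_ok.
- rewrite !tmap_pure; try exact: insr_ok.
  rewrite -[RHS]pureDl; congr (pure _ _ _).
  elim/tensk_ind: s => [|s s' IH IH'|f g].
  + by rewrite !(lin0 (insr_linear _)) addr0.
  + by rewrite !(linD (insr_linear _)) IH IH' addrACA.
  + by rewrite !insr_pure mulrDl purekDr.
Qed.

Lemma compl_balanced (X Y Z : lmodType H) (A : X -> Y -> pst2 Z) z :
  pseudolinear A ->
  balanced ract2 (fun fg e => tmap (insl fg) id (A e z) : pst3 Z).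
Proof.
case=> ADl _ AH; split=> [x x' y|x y y'|x a y].
- exact: tmap_inslDl.
- by rewrite ADl tmapD //; exact: insl_ok.
- by have := AH a 1 y z; rewrite scale1r => ->; rewrite insl_lact2.
Qed.

Lemma compr_balanced (X Y Z : lmodType H) (A : X -> Y -> pst2 Z) x :
  pseudolinear A ->
  balanced ract2 (fun hl d => tmap (insr hl) id (A x d) : pst3 Z).
Proof.
case=> _ ADr AH; split=> [t t' y|t y y'|t a y].
- exact: tmap_insrDl.
- by rewrite ADr tmapD //; exact: insr_ok.
- by have := AH 1 a x y; rewrite scale1r => ->; rewrite insr_lact2.
Qed.

Lemma complD (X Y Z : lmodType H) (A : X -> Y -> pst2 Z) z :
  pseudolinear A -> {morph compl A ^~ z : w w' / w + w'}.
Proof. by move=> hA; apply: tliftD; exact: compl_balanced. Qed.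

Lemma comprD (X Y Z : lmodType H) (A : X -> Y -> pst2 Z) x :
  pseudolinear A -> {morph compr A x : w w' / w + w'}.
Proof. by move=> hA; apply: tliftD; exact: compr_balanced. Qed.

Lemma compl_pure (X Y Z : lmodType H) (A : X -> Y -> pst2 Z)
    (fg : H2) (e : X) (z : Y) (s : seq (H * H * Z)) :
  pseudolinear A ->
  A e z = \sum_(p <- s) pure2 (p.1.1 @t p.1.2) p.2 ->
  compl A (pure2 fg e) z =
    \sum_(p <- s) pure3 (tassoc ((fg * comult p.1.1) @t p.1.2)) p.2.
Proof.
move=> hA E; rewrite [LHS]tlift_pure; last exact: compl_balanced.
rewrite E; elim: s {E} => [|p s IHs].
  by rewrite !big_nil tmap0 //; exact: insl_ok.
rewrite !big_cons -IHs tmapD; last exact: insl_ok.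
by rewrite tmap_pure ?insl_pure //; exact: insl_ok.
Qed.

Lemma compr_pure (X Y Z : lmodType H) (A : X -> Y -> pst2 Z)
    (hl : H2) (x : X) (d : Y) (s : seq (H * H * Z)) :
  pseudolinear A ->
  A x d = \sum_(p <- s) pure2 (p.1.1 @t p.1.2) p.2 ->
  compr A x (pure2 hl d) =
    \sum_(p <- s) pure3 (p.1.1 @t (hl * comult p.1.2)) p.2.
Proof.
move=> hA E; rewrite [LHS]tlift_pure; last exact: compr_balanced.
rewrite E; elim: s {E} => [|p s IHs].
  by rewrite !big_nil tmap0 //; exact: insr_ok.
rewrite !big_cons -IHs tmapD; last exact: insr_ok.
by rewrite tmap_pure ?insr_pure //; exact: insr_ok.
Qed.

End PseudoTensor.

Arguments compl {k H X Y Z} A w z.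
Arguments compr {k H X Y Z} A x w.

HB.mixin Record isLiePseudoalgebra (k : fieldType) (H : cocommHopfAlgType k) L
    of GRing.Lmodule H L := {
  pbr : L -> L -> pst2 L;
  pbr_pseudolinear : pseudolinear pbr;
  pbr_skew : skew pbr;
  pbr_jacobi : forall x y z : L,
    compl pbr (pbr x y) z =
      compr pbr x (pbr y z) - sigma12 (compr pbr y (pbr x z))
}.

#[short(type="liePseudoalgType")]
HB.structure Definition LiePseudoalgebra (k : fieldType)
    (H : cocommHopfAlgType k) :=
  { L of isLiePseudoalgebra k H L & GRing.Lmodule H L }.

Section Theory.
Variables (k : fieldType) (H : cocommHopfAlgType k).

Definition pseudo_hom (L L' : liePseudoalgType H) (f : {linear L -> L'}) :
    Prop :=
  forall x y, pbr (f x) (f y) = pstmap2 f (pbr x y).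

Variables L M : liePseudoalgType H.

Record extension := Extension {
  ext_alg : liePseudoalgType H;
  ext_i : {linear M -> ext_alg};
  ext_p : {linear ext_alg -> L};
  ext_i_hom : pseudo_hom ext_i;
  ext_p_hom : pseudo_hom ext_p;
  ext_i_inj : injective ext_i;
  ext_p_surj : forall x, exists e, ext_p e = x;
  ext_exact : forall e, ext_p e = 0 <-> exists u, ext_i u = e
}.

(* The exact sequence of H-modules underlying E splits. *)
Definition H_split (E : extension) : Prop :=
  exists s : {linear L -> ext_alg E}, cancel s (ext_p E).

Definition ext_equiv (E E' : extension) : Prop :=
  exists T : {linear ext_alg E -> ext_alg E'},
    [/\ pseudo_hom T, T \o ext_i E =1 ext_i E' & ext_p E' \o T =1 ext_p E].

Record cocycle := Cocycle {
  coc_chi : L -> L -> pst2 M;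
  coc_psi : L -> M -> pst2 M;
  coc_chi_pseudolinear : pseudolinear coc_chi;
  coc_chi_skew : skew coc_chi;
  coc_psi_pseudolinear : pseudolinear coc_psi;
  coc_psi_der : forall x u v,
    compl pbr (coc_psi x u) v =
      compr coc_psi x (pbr u v) - sigma12 (compr pbr u (coc_psi x v));
  coc_psi_rep : forall x y u,
    compr coc_psi x (coc_psi y u) - sigma12 (compr coc_psi y (coc_psi x u))
      - compl coc_psi (pbr x y) u = compl pbr (coc_chi x y) u;
  coc_chi_closed : forall x y z,
    compr coc_psi x (coc_chi y z) - sigma12 (compr coc_psi y (coc_chi x z))
      + sigma13 (compr coc_psi z (coc_chi x y))
      + compr coc_chi x (pbr y z) - sigma12 (compr coc_chi y (pbr x z))
      + sigma13 (compr coc_chi z (pbr x y)) = 0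
}.

Definition coc_equiv (c c' : cocycle) : Prop :=
  exists phi : {linear L -> M},
    (forall x u,
       coc_psi c x u - coc_psi c' x u = pbr (phi x) u) /\
    (forall x y,
       coc_chi c x y - coc_chi c' x y =
         coc_psi c' x (phi y) - sigma2 (coc_psi c' y (phi x))
           - pstmap2 phi (pbr x y) + pbr (phi x) (phi y)).

(* The set of classes of a relation; R is an equivalence relation in both uses. *)
Definition classes (T : Type) (R : T -> T -> Prop) : Type :=
  { C : set T | exists x, C = [set y | R x y]%classic }.

(* Only extensions with an H-linear section are described by 2-cocycles.  For
   H = k[x] with x primitive and L = M = k with x acting by 0, all 2-cocycles
   vanish because H^(x)2 (x)_H M has no (x (x) 1)-torsion, whereas a nonsplit
   H-module extension of k by k with zero bracket is a Lie H-pseudoalgebra. *)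
Definition Ext_nab : Type :=
  classes (fun E E' : {E : extension | H_split E} =>
             ext_equiv (proj1_sig E) (proj1_sig E')).

Definition H2_nab : Type := classes coc_equiv.

End Theory.

(* Main.v *)
Require Import Defs.
From HB Require Import structures.
From mathcomp Require Import all_boot all_order all_algebra.
From mathcomp Require Import boolp classical_sets.

(* A cocycle c = (chi, psi) determines a skew-symmetric bracket on the H-module
   L (+) M, with [x * y] = [x * y]_L + chi(x, y) and [x * u] = psi(x, u) for
   x, y in L and u in M.  The jacobiator of a skew-symmetric bracket is invariant
   under cyclic permutations, so it vanishes as soon as it does on LLL, LLM, LMM
   and MMM; there its components are exactly the three cocycle identities and
   the Jacobi identities of L and M.  Hence c yields an extension E_c, and an
   H-linear section s of an extension E identifies E with the E_c given by the
   components of [s x * s y] and [s x * u] along M.  An equivalence E_c -> E_c'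
   must be a shear (x, u) |-> (x, phi x + u), and preservation of brackets is
   the equivalence of c and c' through phi.  So c |-> E_c induces a bijection on
   classes. *)

Set Implicit Arguments.
Unset Strict Implicit.
Unset Printing Implicit Defensive.

Import GRing.Theory.
Local Open Scope ring_scope.

Lemma morphD_zmod (V W : zmodType) (f : V -> W) :
  {morph f : x y / x + y} -> zmod_morphism f.
Proof.
move=> fD x y; have f0 : f 0 = 0 by apply: (addrI (f 0)); rewrite -fD !addr0.
by apply/eqP; rewrite eq_sym subr_eq -fD subrK.
Qed.

(** * Functoriality of the pseudo-tensor products and the permutations of their factors *)

Section PseudoTensorMaps.
Variables (k : fieldType) (H : cocommHopfAlgType k).
Local Notation H2 := (H *t H).
Local Notation H3 := (H *t (H *t H)).
Implicit Types X Y Z : lmodType H.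

Definition pstmap3 Z Z' (f : Z -> Z') : pst3 Z -> pst3 Z' := tmap id f.

(** [pstinsl] and [pstinsr] are what the compositions [compl] and [compr] become when the composed
    tensor is pure. *)
Definition pstinsl Z (t : H2) : pst2 Z -> pst3 Z := tmap (insl t) id.
Definition pstinsr Z (t : H2) : pst2 Z -> pst3 Z := tmap (insr t) id.

Lemma pstmap2_ok Z Z' (f : {linear Z -> Z'}) :
  tmap_ok (@ract2 k H) (@ract2 k H) id f.
Proof. by apply: equivar_tmap_ok => //; exact: linearP. Qed.

Lemma pstmap3_ok Z Z' (f : {linear Z -> Z'}) :
  tmap_ok (@ract3 k H) (@ract3 k H) id f.
Proof. by apply: equivar_tmap_ok => //; exact: linearP. Qed.

Lemma sigma2_ok Z : tmap_ok (@ract2 k H) (@ract2 k H) (@tswap k H H) (@id Z).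
Proof.
apply: equivar_tmap_ok => // [|x a]; first exact: linD (@tswap_linear _ _ _).
by rewrite /ract2 tswapM comultC.
Qed.

Lemma sigma12_ok Z : tmap_ok (@ract3 k H) (@ract3 k H) (@perm12 k H) (@id Z).
Proof.
apply: equivar_tmap_ok => // [|x a]; first exact: linD (@perm12_linear _ _).
by rewrite /ract3 perm12M comult3_perm12.
Qed.

Lemma sigma13_ok Z : tmap_ok (@ract3 k H) (@ract3 k H) (@perm13 k H) (@id Z).
Proof.
apply: equivar_tmap_ok => // [|x a]; first exact: linD (@perm13_linear _ _).
by rewrite /ract3 perm13M comult3_perm13.
Qed.

(** Additive structures let [raddf0], [raddfD] and [raddfN] drive the inductions on tensors
    below. *)
HB.instance Definition _ Z Z' (f : {linear Z -> Z'}) :=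
  GRing.isZmodMorphism.Build (pst2 Z) (pst2 Z') (pstmap2 f)
    (morphD_zmod (tmapD (pstmap2_ok f))).
HB.instance Definition _ Z Z' (f : {linear Z -> Z'}) :=
  GRing.isZmodMorphism.Build (pst3 Z) (pst3 Z') (pstmap3 f)
    (morphD_zmod (tmapD (pstmap3_ok f))).
HB.instance Definition _ Z :=
  GRing.isZmodMorphism.Build (pst2 Z) (pst2 Z) (@sigma2 k H Z)
    (morphD_zmod (tmapD (@sigma2_ok Z))).
HB.instance Definition _ Z :=
  GRing.isZmodMorphism.Build (pst3 Z) (pst3 Z) (@sigma12 k H Z)
    (morphD_zmod (tmapD (@sigma12_ok Z))).
HB.instance Definition _ Z :=
  GRing.isZmodMorphism.Build (pst3 Z) (pst3 Z) (@sigma13 k H Z)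
    (morphD_zmod (tmapD (@sigma13_ok Z))).
HB.instance Definition _ Z (t : H2) :=
  GRing.isZmodMorphism.Build (pst2 Z) (pst2 Z) (@lact2 k H Z t)
    (morphD_zmod (@lact2D k H Z t)).
HB.instance Definition _ Z (t : H2) :=
  GRing.isZmodMorphism.Build (pst2 Z) (pst3 Z) (@pstinsl Z t)
    (morphD_zmod (tmapD (@insl_ok k H Z t))).
HB.instance Definition _ Z (t : H2) :=
  GRing.isZmodMorphism.Build (pst2 Z) (pst3 Z) (@pstinsr Z t)
    (morphD_zmod (tmapD (@insr_ok k H Z t))).

(** This and the next lemmas fix the map in [raddfD] and [raddfN], so that rewriting, also from
    right to left, picks the intended map. *)
Lemma pstmap2D Z Z' (f : {linear Z -> Z'}) :
  {morph (pstmap2 f : pst2 Z -> pst2 Z') : v w / v + w}.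
Proof. exact: raddfD. Qed.

Lemma pstmap2N Z Z' (f : {linear Z -> Z'}) :
  {morph (pstmap2 f : pst2 Z -> pst2 Z') : v / - v}.
Proof. exact: raddfN. Qed.

Lemma pstmap3D Z Z' (f : {linear Z -> Z'}) : {morph pstmap3 f : v w / v + w}.
Proof. exact: raddfD. Qed.

Lemma pstmap3N Z Z' (f : {linear Z -> Z'}) : {morph pstmap3 f : v / - v}.
Proof. exact: raddfN. Qed.

Lemma sigma2D Z : {morph @sigma2 k H Z : v w / v + w}.
Proof. exact: raddfD. Qed.

Lemma sigma2N Z : {morph @sigma2 k H Z : v / - v}.
Proof. exact: raddfN. Qed.

Lemma sigma12D Z : {morph @sigma12 k H Z : v w / v + w}.
Proof. exact: raddfD. Qed.

Lemma sigma13D Z : {morph @sigma13 k H Z : v w / v + w}.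
Proof. exact: raddfD. Qed.

Lemma pst2_ind Z (P : pst2 Z -> Prop) :
  P 0 -> (forall v w, P v -> P w -> P (v + w)) ->
  (forall t z, P (pure2 t z)) -> forall w, P w.
Proof. exact: tens_ind. Qed.

Lemma pst3_ind Z (P : pst3 Z -> Prop) :
  P 0 -> (forall v w, P v -> P w -> P (v + w)) ->
  (forall t z, P (pure3 t z)) -> forall w, P w.
Proof. exact: tens_ind. Qed.

Lemma pstmap3_pure Z Z' (f : {linear Z -> Z'}) (t : H3) (z : Z) :
  pstmap3 f (pure3 t z) = pure3 t (f z).
Proof. by apply: tmap_pure; exact: pstmap3_ok. Qed.

Lemma pstinsl_pure Z (t s : H2) (z : Z) :
  pstinsl t (pure2 s z) = pure3 (insl t s) z.
Proof. by apply: tmap_pure; exact: insl_ok. Qed.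

Lemma pstinsr_pure Z (t s : H2) (z : Z) :
  pstinsr t (pure2 s z) = pure3 (insr t s) z.
Proof. by apply: tmap_pure; exact: insr_ok. Qed.

Lemma tswapK (U V : lmodType k) : cancel (@tswap k U V) (@tswap k V U).
Proof.
apply: tensk_ext => [||u v]; rewrite ?tswapE //.
by apply: lin_comp; exact: tswap_linear.
Qed.

Lemma pstmap2_comp Z Z' Z'' (g : {linear Z' -> Z''}) (f : {linear Z -> Z'})
    (w : pst2 Z) :
  pstmap2 g (pstmap2 f w) = pstmap2 (g \o f) w.
Proof.
by elim/pst2_ind: w => [|v w IHv IHw|t z];
  rewrite ?raddf0 ?raddfD /= ?IHv ?IHw ?pstmap2_pure.
Qed.

Lemma pstmap3_comp Z Z' Z'' (g : {linear Z' -> Z''}) (f : {linear Z -> Z'})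
    (w : pst3 Z) :
  pstmap3 g (pstmap3 f w) = pstmap3 (g \o f) w.
Proof.
by elim/pst3_ind: w => [|v w IHv IHw|t z];
  rewrite ?raddf0 ?raddfD /= ?IHv ?IHw ?pstmap3_pure.
Qed.

Lemma eq_pstmap2 Z Z' (f g : {linear Z -> Z'}) :
  f =1 g -> forall w : pst2 Z, pstmap2 f w = pstmap2 g w.
Proof.
by move=> fg; elim/pst2_ind => [|v w IHv IHw|t z];
  rewrite ?raddf0 ?raddfD /= ?IHv ?IHw ?pstmap2_pure ?fg.
Qed.

Lemma eq_pstmap3 Z Z' (f g : {linear Z -> Z'}) :
  f =1 g -> forall w : pst3 Z, pstmap3 f w = pstmap3 g w.
Proof.
by move=> fg; elim/pst3_ind => [|v w IHv IHw|t z];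
  rewrite ?raddf0 ?raddfD /= ?IHv ?IHw ?pstmap3_pure ?fg.
Qed.

Lemma pstmap2_id Z (w : pst2 Z) : pstmap2 idfun w = w.
Proof.
by elim/pst2_ind: w => [|v w IHv IHw|t z];
  rewrite ?raddf0 ?raddfD /= ?IHv ?IHw ?pstmap2_pure.
Qed.

Lemma pstmap3_id Z (w : pst3 Z) : pstmap3 idfun w = w.
Proof.
by elim/pst3_ind: w => [|v w IHv IHw|t z];
  rewrite ?raddf0 ?raddfD /= ?IHv ?IHw ?pstmap3_pure.
Qed.

Lemma pstmap2_add Z Z' (f g : {linear Z -> Z'}) (w : pst2 Z) :
  pstmap2 (f \+ g) w = pstmap2 f w + pstmap2 g w.
Proof.
elim/pst2_ind: w => [|v w IHv IHw|t z]; first by rewrite !raddf0 addr0.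
  by rewrite !raddfD /= IHv IHw addrACA.
by rewrite !pstmap2_pure [RHS]/GRing.add /= -[RHS]pureDr.
Qed.

Lemma pstmap2_null Z Z' (w : pst2 Z) : pstmap2 (\0 : Z -> Z') w = 0.
Proof.
elim/pst2_ind: w => [|v w IHv IHw|t z]; first by rewrite raddf0.
  by rewrite !raddfD /= IHv IHw addr0.
rewrite pstmap2_pure /=; apply: (addrI (pure2 t (0 : Z'))).
by rewrite -[LHS]pureDr !addr0.
Qed.

Lemma lact2_pstmap2 Z Z' (f : {linear Z -> Z'}) (t : H2) (w : pst2 Z) :
  lact2 t (pstmap2 f w) = pstmap2 f (lact2 t w).
Proof.
by elim/pst2_ind: w => [|v w IHv IHw|s z];
  rewrite ?raddf0 ?raddfD /= ?IHv ?IHw ?(pstmap2_pure, lact2_pure).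
Qed.

Lemma lact2_sigma2 Z (t : H2) (w : pst2 Z) :
  lact2 t (sigma2 w) = sigma2 (lact2 (tswap t) w).
Proof.
elim/pst2_ind: w => [|v w IHv IHw|s z]; rewrite ?raddf0 ?raddfD /= ?IHv ?IHw //.
rewrite sigma2_pure !lact2_pure sigma2_pure tswapM.
by rewrite (_ : tswap (tswap t) = t) //; exact: tswapK.
Qed.

Lemma sigma2K Z (w : pst2 Z) : sigma2 (sigma2 w) = w.
Proof.
by elim/pst2_ind: w => [|v w IHv IHw|s z];
  rewrite ?raddf0 ?raddfD /= ?IHv ?IHw ?sigma2_pure ?tswapK.
Qed.

Lemma sigma2_pstmap2 Z Z' (f : {linear Z -> Z'}) (w : pst2 Z) :
  sigma2 (pstmap2 f w) = pstmap2 f (sigma2 w).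
Proof.
by elim/pst2_ind: w => [|v w IHv IHw|s z];
  rewrite ?raddf0 ?raddfD /= ?IHv ?IHw ?(pstmap2_pure, sigma2_pure).
Qed.

Lemma sigma12_pstmap3 Z Z' (f : {linear Z -> Z'}) (w : pst3 Z) :
  sigma12 (pstmap3 f w) = pstmap3 f (sigma12 w).
Proof.
by elim/pst3_ind: w => [|v w IHv IHw|s z];
  rewrite ?raddf0 ?raddfD /= ?IHv ?IHw ?(pstmap3_pure, sigma12_pure).
Qed.

Lemma sigma13_pstmap3 Z Z' (f : {linear Z -> Z'}) (w : pst3 Z) :
  sigma13 (pstmap3 f w) = pstmap3 f (sigma13 w).
Proof.
by elim/pst3_ind: w => [|v w IHv IHw|s z];
  rewrite ?raddf0 ?raddfD /= ?IHv ?IHw ?(pstmap3_pure, sigma13_pure).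
Qed.

Lemma perm13K (t : H3) : perm13 (perm13 (perm13 t)) = t.
Proof.
elim/tens3_ind: t => [|s t IHs IHt|a b c].
  by rewrite !(lin0 (@perm13_linear _ _)).
  by rewrite !(linD (@perm13_linear _ _)) IHs IHt.
by rewrite !perm13E.
Qed.

(** In the symmetric group on three letters, conjugation by a transposition inverts a 3-cycle, and
    the inverse of a 3-cycle is its square. *)
Lemma perm12_13_12 (t : H3) : perm12 (perm13 (perm12 t)) = perm13 (perm13 t).
Proof.
elim/tens3_ind: t => [|s t IHs IHt|a b c].
- by rewrite !(lin0 (@perm13_linear _ _), lin0 (@perm12_linear _ _)).
- by rewrite !(linD (@perm13_linear _ _), linD (@perm12_linear _ _)) IHs IHt.
- by rewrite !(perm13E, perm12E).
Qed.

Lemma sigma13K Z (w : pst3 Z) : sigma13 (sigma13 (sigma13 w)) = w.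
Proof.
by elim/pst3_ind: w => [|v w IHv IHw|s z];
  rewrite ?raddf0 ?raddfD /= ?IHv ?IHw ?sigma13_pure ?perm13K.
Qed.

Lemma sigma12_13_12 Z (w : pst3 Z) :
  sigma12 (sigma13 (sigma12 w)) = sigma13 (sigma13 w).
Proof.
by elim/pst3_ind: w => [|v w IHv IHw|s z];
  rewrite ?raddf0 ?raddfD /= ?IHv ?IHw ?(sigma13_pure, sigma12_pure)
    ?perm12_13_12.
Qed.

Lemma perm13_pure (a : H) (t : H2) : perm13 (a @t t) = tassoc (t @t a).
Proof.
elim/tensk_ind: t => [|s t IHs IHt|b c].
- rewrite (lin0 (@purek_linearl _ _ _ a)) (lin0 (@purek_linearr _ _ _ a)).
  by rewrite (lin0 (@tassoc_linear _ _ _ _)) (lin0 (@perm13_linear _ _)).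
- rewrite purekDl purekDr (linD (@tassoc_linear _ _ _ _)).
  by rewrite (linD (@perm13_linear _ _)) IHs IHt.
- by rewrite tassocE perm13E.
Qed.

Lemma perm13_12_pure (a : H) (t : H2) :
  perm13 (perm12 (a @t t)) = a @t tswap t.
Proof.
elim/tensk_ind: t => [|s t IHs IHt|b c].
- rewrite (lin0 (@tswap_linear _ _ _)) !(lin0 (@purek_linearr _ _ _ a)).
  by rewrite (lin0 (@perm12_linear _ _)) (lin0 (@perm13_linear _ _)).
- rewrite (linD (@tswap_linear _ _ _)) !purekDr (linD (@perm12_linear _ _)).
  by rewrite (linD (@perm13_linear _ _)) IHs IHt.
- by rewrite tswapE perm12E perm13E.
Qed.

(** The composite of [perm12] and [perm13] transposes the last two factors. Cocommutativity enters
    here: [tswap] fixes the coproduct that multiplies [t]. *)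
Lemma insr_tswapl (t s : H2) : insr (tswap t) s = perm13 (perm12 (insr t s)).
Proof.
elim/tensk_ind: s => [|s s' IHs IHt|f g].
- rewrite !(lin0 (insr_linear _)) (lin0 (@perm12_linear _ _)).
  by rewrite (lin0 (@perm13_linear _ _)).
- rewrite !(linD (insr_linear _)) (linD (@perm12_linear _ _)).
  by rewrite (linD (@perm13_linear _ _)) IHs IHt.
- by rewrite !insr_pure perm13_12_pure tswapM comultC.
Qed.

(** For [s] equal to f (x) g, both sides are t Delta(g) (x) f: the rotation carries the leading
    factor f to the end. *)
Lemma insl_tswapr (t s : H2) : insl t (tswap s) = perm13 (insr t s).
Proof.
elim/tensk_ind: s => [|s s' IHs IHt|f g].
- rewrite (lin0 (@tswap_linear _ _ _)) (lin0 (insl_linear _)).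
  by rewrite (lin0 (insr_linear _)) (lin0 (@perm13_linear _ _)).
- rewrite (linD (@tswap_linear _ _ _)) (linD (insl_linear _)).
  by rewrite (linD (insr_linear _)) (linD (@perm13_linear _ _)) IHs IHt.
- by rewrite tswapE insl_pure insr_pure perm13_pure.
Qed.

End PseudoTensorMaps.

(** * Constructions on pseudolinear maps; naturality and symmetry of the two compositions *)

Section Compositions.
Variables (k : fieldType) (H : cocommHopfAlgType k).
Local Notation H2 := (H *t H).
Implicit Types X Y Z : lmodType H.

Lemma pseudolinear0l X Y Z (A : X -> Y -> pst2 Z) (y : Y) :
  pseudolinear A -> A 0 y = 0.
Proof. by case=> ADl _ _; apply: (addrI (A 0 y)); rewrite -ADl !addr0. Qed.

Lemma pseudolinear0r X Y Z (A : X -> Y -> pst2 Z) (x : X) :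
  pseudolinear A -> A x 0 = 0.
Proof. by case=> _ ADr _; apply: (addrI (A x 0)); rewrite -ADr !addr0. Qed.

Lemma pseudolinear_pre X X' Y Y' Z (f : {linear X -> X'}) (g : {linear Y -> Y'})
    (A : X' -> Y' -> pst2 Z) :
  pseudolinear A -> pseudolinear (fun x y => A (f x) (g y)).
Proof.
by case=> ADl ADr AH; split=> *; rewrite ?linearD ?linearZ /= ?ADl ?ADr ?AH.
Qed.

Lemma pseudolinear_pstmap2 X Y Z Z' (f : {linear Z -> Z'})
    (A : X -> Y -> pst2 Z) :
  pseudolinear A -> pseudolinear (fun x y => pstmap2 f (A x y)).
Proof.
by case=> ADl ADr AH; split=> *; rewrite ?ADl ?ADr ?AH ?raddfD ?lact2_pstmap2.
Qed.

Lemma pseudolinear_add X Y Z (A B : X -> Y -> pst2 Z) :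
  pseudolinear A -> pseudolinear B -> pseudolinear (fun x y => A x y + B x y).
Proof.
case=> ADl ADr AH [BDl BDr BH].
by split=> *; rewrite ?ADl ?ADr ?AH ?BDl ?BDr ?BH 1?addrACA // raddfD.
Qed.

Lemma pseudolinear_opp X Y Z (A : X -> Y -> pst2 Z) :
  pseudolinear A -> pseudolinear (fun x y => - A x y).
Proof.
by case=> ADl ADr AH; split=> *; rewrite ?ADl ?ADr ?AH ?opprD // raddfN.
Qed.

Lemma pseudolinear_flip X Y Z (A : X -> Y -> pst2 Z) :
  pseudolinear A -> pseudolinear (fun y x => sigma2 (A x y)).
Proof.
case=> ADl ADr AH; split=> *; rewrite ?ADl ?ADr ?AH ?raddfD //.
by rewrite lact2_sigma2 tswapE.
Qed.

(** In contrast with [compl_pure], the value [A x y] is not expanded into pure tensors, which suits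
    induction on the composed tensor alone. *)
Lemma compl_pure2 X Y Z (A : X -> Y -> pst2 Z) (t : H2) (x : X) (y : Y) :
  pseudolinear A -> compl A (pure2 t x) y = pstinsl t (A x y).
Proof. by move=> hA; apply: tlift_pure; exact: compl_balanced. Qed.

Lemma compr_pure2 X Y Z (A : X -> Y -> pst2 Z) (t : H2) (x : X) (y : Y) :
  pseudolinear A -> compr A x (pure2 t y) = pstinsr t (A x y).
Proof. by move=> hA; apply: tlift_pure; exact: compr_balanced. Qed.

Lemma compl_zmod X Y Z (A : X -> Y -> pst2 Z) (y : Y) :
  pseudolinear A -> zmod_morphism (compl A ^~ y).
Proof. by move=> hA; exact: morphD_zmod (complD y hA). Qed.

Lemma compr_zmod X Y Z (A : X -> Y -> pst2 Z) (x : X) :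
  pseudolinear A -> zmod_morphism (compr A x).
Proof. by move=> hA; exact: morphD_zmod (comprD x hA). Qed.

Lemma compl0 X Y Z (A : X -> Y -> pst2 Z) (y : Y) :
  pseudolinear A -> compl A 0 y = 0.
Proof. by move=> hA; have := compl_zmod y hA 0 0; rewrite /= !subrr. Qed.

Lemma compr0 X Y Z (A : X -> Y -> pst2 Z) (x : X) :
  pseudolinear A -> compr A x 0 = 0.
Proof. by move=> hA; have := compr_zmod x hA 0 0; rewrite /= !subrr. Qed.

Lemma comprN X Y Z (A : X -> Y -> pst2 Z) (x : X) (w : pst2 Y) :
  pseudolinear A -> compr A x (- w) = - compr A x w.
Proof.
by move=> hA; have := compr_zmod x hA 0 w; rewrite /= compr0 // !sub0r.
Qed.

Lemma comprDx X Y Z (A : X -> Y -> pst2 Z) (x x' : X) (w : pst2 Y) :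
  pseudolinear A -> compr A (x + x') w = compr A x w + compr A x' w.
Proof.
move=> hA; have [ADl _ _] := hA.
elim/pst2_ind: w => [|v w IHv IHw|t y]; first by rewrite !compr0 // addr0.
  by rewrite !comprD // IHv IHw addrACA.
by rewrite !compr_pure2 // ADl raddfD.
Qed.

Lemma compr_sigma2 X Y Z (A : X -> Y -> pst2 Z) (x : X) (w : pst2 Y) :
  pseudolinear A -> compr A x (sigma2 w) = sigma13 (sigma12 (compr A x w)).
Proof.
move=> hA; elim/pst2_ind: w => [|v w IHv IHw|t y].
- by rewrite raddf0 compr0 // !raddf0.
- by rewrite raddfD !comprD // IHv IHw !raddfD.
rewrite sigma2_pure !compr_pure2 //.
by elim/pst2_ind: (A x y) => [|v w IHv IHw|s z];
  rewrite ?raddf0 ?raddfD /= ?IHv ?IHw //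
    !pstinsr_pure sigma12_pure sigma13_pure insr_tswapl.
Qed.

Lemma pstinsl_sigma2 Z (t : H2) (w : pst2 Z) :
  pstinsl t (sigma2 w) = sigma13 (pstinsr t w).
Proof.
by elim/pst2_ind: w => [|v w IHv IHw|s z];
  rewrite ?raddf0 ?raddfD /= ?IHv ?IHw //
    sigma2_pure pstinsr_pure pstinsl_pure sigma13_pure insl_tswapr.
Qed.

(** Skew-symmetry moves [x] to the first argument of [A], and the resulting swap becomes a rotation
    by [pstinsl_sigma2]. All terms of a Jacobi identity can thus be written with [compr]. *)
Lemma compl_skew X Z (A : X -> X -> pst2 Z) (w : pst2 X) (x : X) :
  pseudolinear A -> Defs.skew A -> compl A w x = - sigma13 (compr A x w).
Proof.
move=> hA skA; elim/pst2_ind: w => [|v w IHv IHw|t y].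
- by rewrite compl0 // compr0 // raddf0 oppr0.
- by rewrite complD // comprD // IHv IHw raddfD opprD.
- by rewrite compl_pure2 // compr_pure2 // (skA x) raddfN /= pstinsl_sigma2.
Qed.

Lemma pstinsl_pstmap2 Z Z' (f : {linear Z -> Z'}) (t : H2) (w : pst2 Z) :
  pstinsl t (pstmap2 f w) = pstmap3 f (pstinsl t w).
Proof.
by elim/pst2_ind: w => [|v w IHv IHw|s z];
  rewrite ?raddf0 ?raddfD /= ?IHv ?IHw //
    pstmap2_pure !pstinsl_pure pstmap3_pure.
Qed.

Lemma pstinsr_pstmap2 Z Z' (f : {linear Z -> Z'}) (t : H2) (w : pst2 Z) :
  pstinsr t (pstmap2 f w) = pstmap3 f (pstinsr t w).
Proof.
by elim/pst2_ind: w => [|v w IHv IHw|s z];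
  rewrite ?raddf0 ?raddfD /= ?IHv ?IHw //
    pstmap2_pure !pstinsr_pure pstmap3_pure.
Qed.

(** The compatibility is required only at the fixed pair [y], [y'], so that [A] may be a mere
    component of [A'], such as [psi] inside the bracket on L (+) M. *)
Lemma compl_natural X X' Y Y' Z Z' (A : X -> Y -> pst2 Z)
    (A' : X' -> Y' -> pst2 Z')
    (f : {linear X -> X'}) (y : Y) (y' : Y') (h : {linear Z -> Z'}) :
  pseudolinear A -> pseudolinear A' ->
  (forall x, A' (f x) y' = pstmap2 h (A x y)) ->
  forall w, compl A' (pstmap2 f w) y' = pstmap3 h (compl A w y).
Proof.
move=> hA hA' AA'; elim/pst2_ind => [|v w IHv IHw|t x].
- by rewrite raddf0 !compl0 // raddf0.
- by rewrite raddfD !complD // IHv IHw raddfD.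
- by rewrite pstmap2_pure !compl_pure2 // AA' pstinsl_pstmap2.
Qed.

Lemma compr_natural X X' Y Y' Z Z' (A : X -> Y -> pst2 Z)
    (A' : X' -> Y' -> pst2 Z')
    (x : X) (x' : X') (g : {linear Y -> Y'}) (h : {linear Z -> Z'}) :
  pseudolinear A -> pseudolinear A' ->
  (forall y, A' x' (g y) = pstmap2 h (A x y)) ->
  forall w, compr A' x' (pstmap2 g w) = pstmap3 h (compr A x w).
Proof.
move=> hA hA' AA'; elim/pst2_ind => [|v w IHv IHw|t y].
- by rewrite raddf0 !compr0 // raddf0.
- by rewrite raddfD !comprD // IHv IHw raddfD.
- by rewrite pstmap2_pure !compr_pure2 // AA' pstinsr_pstmap2.
Qed.

(** The variant for a bracket with two components, as for two elements of L, whose bracket has a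
    part in L and a part in M. *)
Lemma compr_natural2 X' Y Y' Z1 Z2 Z' X1 X2 (A1 : X1 -> Y -> pst2 Z1)
    (A2 : X2 -> Y -> pst2 Z2) (A' : X' -> Y' -> pst2 Z')
    (x1 : X1) (x2 : X2) (x' : X') (g : {linear Y -> Y'})
    (h1 : {linear Z1 -> Z'}) (h2 : {linear Z2 -> Z'}) :
  pseudolinear A1 -> pseudolinear A2 -> pseudolinear A' ->
  (forall y, A' x' (g y) = pstmap2 h1 (A1 x1 y) + pstmap2 h2 (A2 x2 y)) ->
  forall w, compr A' x' (pstmap2 g w) =
    pstmap3 h1 (compr A1 x1 w) + pstmap3 h2 (compr A2 x2 w).
Proof.
move=> hA1 hA2 hA' AA'; elim/pst2_ind => [|v w IHv IHw|t y].
- by rewrite raddf0 !compr0 // !raddf0 addr0.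
- by rewrite raddfD !comprD // IHv IHw !raddfD addrACA.
- by rewrite pstmap2_pure !compr_pure2 // AA' raddfD /= !pstinsr_pstmap2.
Qed.

End Compositions.

(** * The jacobiator of a skew-symmetric bracket and its cyclic symmetry *)

Section Jacobiator.
Variables (k : fieldType) (H : cocommHopfAlgType k) (X : lmodType H).
Variable B : X -> X -> pst2 X.

Definition jacobiator (a b c : X) : pst3 X :=
  compl B (B a b) c - compr B a (B b c) + sigma12 (compr B b (B a c)).

Lemma jacobiator_eq0 a b c : jacobiator a b c = 0 <->
  compl B (B a b) c = compr B a (B b c) - sigma12 (compr B b (B a c)).
Proof.
rewrite /jacobiator addrAC -addrA -opprB.
by split=> [/eqP|->]; [rewrite subr_eq0 => /eqP | exact: subrr].
Qed.

Hypotheses (B_lin : pseudolinear B) (B_skew : Defs.skew B).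

Lemma jacobiator_compr a b c : jacobiator a b c =
  - (compr B a (B b c) - sigma12 (compr B b (B a c))
       + sigma13 (compr B c (B a b))).
Proof. by rewrite /jacobiator compl_skew // !opprD opprK -addrA addrC. Qed.

(** Replacing [B a c] by the opposite of the swapped [B c a] turns the middle term of
    [jacobiator_compr] into the conjugate of [sigma13] by [sigma12], that is, [sigma13] squared. *)
Lemma jacobiator_cyclic_sum a b c : jacobiator a b c =
  - (compr B a (B b c) + sigma13 (sigma13 (compr B b (B c a)))
       + sigma13 (compr B c (B a b))).
Proof.
rewrite jacobiator_compr (B_skew c a) comprN // raddfN /= opprK compr_sigma2 //.
by rewrite sigma12_13_12.
Qed.

(** Since [sigma13] has order dividing three, it merely permutes the three terms of the cyclic
    sum. *)
Lemma jacobiator_cycle a b c : jacobiator a b c = sigma13 (jacobiator c a b).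
Proof.
rewrite !jacobiator_cyclic_sum raddfN !raddfD /= sigma13K.
by rewrite addrC addrA.
Qed.

Lemma jacobiatorDl a a' b c :
  jacobiator (a + a') b c = jacobiator a b c + jacobiator a' b c.
Proof.
have [BDl _ _] := B_lin.
rewrite /jacobiator !BDl complD // !comprD // comprDx // opprD raddfD /=.
by rewrite [RHS]addrACA; congr (_ + _); rewrite addrACA.
Qed.

End Jacobiator.

(** * The bracket on L (+) M defined by [chi] and [psi], and its Jacobi identity *)

Section SplitBracket.
Variables (k : fieldType) (H : cocommHopfAlgType k) (L M : liePseudoalgType H).
Local Notation N := (L * M)%type.

Definition linear_fun_of (U V : lmodType H) (f : U -> V) (lf : linear f) :
  {linear U -> V} := HB.pack f (GRing.isLinear.Build H U V _ f lf).

Fact inl_linear : linear (fun x : L => (x, 0) : N).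
Proof. by move=> a x y; congr pair; rewrite /= scaler0 addr0. Qed.

Fact inr_linear : linear (fun u : M => (0, u) : N).
Proof. by move=> a x y; congr pair; rewrite /= scaler0 addr0. Qed.

Definition inL : {linear L -> N} := linear_fun_of inl_linear.
Definition inM : {linear M -> N} := linear_fun_of inr_linear.

Definition prL : {linear N -> L} := fst.
Definition prM : {linear N -> M} := snd.

Lemma split_pairE (p : N) : p = inL p.1 + inM p.2.
Proof. by case: p => x u; congr pair; rewrite /= ?addr0 ?add0r. Qed.

Lemma prL_inLM (v : pst2 L) (w : pst2 M) :
  pstmap2 prL (pstmap2 inL v + pstmap2 inM w) = v.
Proof.
rewrite pstmap2D !pstmap2_comp (@eq_pstmap2 _ _ _ _ (prL \o inL) idfun) //.
rewrite (@eq_pstmap2 _ _ _ _ (prL \o inM) \0) //.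
by rewrite pstmap2_id pstmap2_null addr0.
Qed.

Lemma prM_inLM (v : pst2 L) (w : pst2 M) :
  pstmap2 prM (pstmap2 inL v + pstmap2 inM w) = w.
Proof.
rewrite pstmap2D !pstmap2_comp (@eq_pstmap2 _ _ _ _ (prM \o inM) idfun) //.
rewrite (@eq_pstmap2 _ _ _ _ (prM \o inL) \0) //.
by rewrite pstmap2_id pstmap2_null add0r.
Qed.

(** The retraction [prM] of [inM] induces a left inverse. This is what allows an identity in M to be
    read off from its image in L (+) M. *)
Lemma pstmap3_inM_inj : injective (pstmap3 inM).
Proof.
apply: (@can_inj _ _ _ (pstmap3 prM)) => w.
by rewrite pstmap3_comp (@eq_pstmap3 _ _ _ _ _ idfun) // pstmap3_id.
Qed.

Variables (chi : L -> L -> pst2 M) (psi : L -> M -> pst2 M).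

(** The term in [sigma2] is the bracket of an element of M with one of L, as forced by
    skew-symmetry. *)
Definition split_bracket (p q : N) : pst2 N :=
  pstmap2 inL (pbr p.1 q.1)
  + pstmap2 inM (chi p.1 q.1 + psi p.1 q.2 - sigma2 (psi q.1 p.2)
                 + pbr p.2 q.2).

Hypotheses (chi_lin : pseudolinear chi) (chi_skew : Defs.skew chi).
Hypothesis psi_lin : pseudolinear psi.

Lemma split_bracket_pseudolinear : pseudolinear split_bracket.
Proof.
have hL := pseudolinear_pre prL prL (@pbr_pseudolinear k H L).
have hM := pseudolinear_pre prM prM (@pbr_pseudolinear k H M).
have hc := pseudolinear_pre prL prL chi_lin.
have hp := pseudolinear_pre prL prM psi_lin.
have hp' := pseudolinear_opp (pseudolinear_flip hp).
apply: pseudolinear_add; first exact: pseudolinear_pstmap2 hL.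
apply: (pseudolinear_pstmap2 inM).
apply: pseudolinear_add hM; apply: pseudolinear_add hp'.
exact: pseudolinear_add.
Qed.

Lemma split_bracket_skew : Defs.skew split_bracket.
Proof.
move=> p q; rewrite /split_bracket sigma2D !sigma2_pstmap2 opprD -!pstmap2N.
rewrite -!pbr_skew; congr (_ + pstmap2 _ _).
rewrite (chi_skew q.1) pbr_skew !sigma2D !sigma2N !sigma2K !opprD !opprK.
by congr (_ + _); exact: addrAC.
Qed.


Let pbr0l (K : liePseudoalgType H) (x : K) : pbr 0 x = 0.
Proof. exact: pseudolinear0l (@pbr_pseudolinear _ _ K). Qed.
Let pbr0r (K : liePseudoalgType H) (x : K) : pbr x 0 = 0.
Proof. exact: pseudolinear0r (@pbr_pseudolinear _ _ K). Qed.
Let psi0l u : psi 0 u = 0. Proof. exact: pseudolinear0l. Qed.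
Let psi0r x : psi x 0 = 0. Proof. exact: pseudolinear0r. Qed.
Let chi0l x : chi 0 x = 0. Proof. exact: pseudolinear0l. Qed.
Let chi0r x : chi x 0 = 0. Proof. exact: pseudolinear0r. Qed.
Let inL1 x : (inL x).1 = x. Proof. by []. Qed.
Let inL2 x : (inL x).2 = 0. Proof. by []. Qed.
Let inM1 u : (inM u).1 = 0. Proof. by []. Qed.
Let inM2 u : (inM u).2 = u. Proof. by []. Qed.
Let zeros := (inL1, inL2, inM1, inM2, pbr0l, pbr0r, psi0l, psi0r, chi0l, chi0r).

Lemma split_bracketLL x y : split_bracket (inL x) (inL y) =
  pstmap2 inL (pbr x y) + pstmap2 inM (chi x y).
Proof. by rewrite /split_bracket !zeros !raddf0 ?addr0 ?add0r. Qed.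

Lemma split_bracketLM x u :
  split_bracket (inL x) (inM u) = pstmap2 inM (psi x u).
Proof. by rewrite /split_bracket !zeros !raddf0 ?addr0 ?add0r. Qed.

Lemma split_bracketMM u v :
  split_bracket (inM u) (inM v) = pstmap2 inM (pbr u v).
Proof. by rewrite /split_bracket !zeros !raddf0 ?addr0 ?add0r. Qed.

Local Notation J := (jacobiator split_bracket).
Let B_lin := split_bracket_pseudolinear.
Let B_skew := split_bracket_skew.

Lemma compr_split_LL x w : compr split_bracket (inL x) (pstmap2 inL w) =
  pstmap3 inL (compr pbr x w) + pstmap3 inM (compr chi x w).
Proof.
apply: compr_natural2 => //; first exact: pbr_pseudolinear.
exact: split_bracketLL.
Qed.

Lemma compr_split_LM x w :
  compr split_bracket (inL x) (pstmap2 inM w) = pstmap3 inM (compr psi x w).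
Proof. by apply: compr_natural => // u; exact: split_bracketLM. Qed.

Lemma compr_split_MM u w :
  compr split_bracket (inM u) (pstmap2 inM w) = pstmap3 inM (compr pbr u w).
Proof.
apply: compr_natural => // [|v]; first exact: pbr_pseudolinear.
exact: split_bracketMM.
Qed.

Lemma compl_split_LM w u :
  compl split_bracket (pstmap2 inL w) (inM u) = pstmap3 inM (compl psi w u).
Proof. by apply: compl_natural => // x; exact: split_bracketLM. Qed.

Lemma compl_split_MM w u :
  compl split_bracket (pstmap2 inM w) (inM u) = pstmap3 inM (compl pbr w u).
Proof.
apply: compl_natural => // [|v]; first exact: pbr_pseudolinear.
exact: split_bracketMM.
Qed.

Lemma jacobiator_MMM u v w : J (inM u) (inM v) (inM w) = 0.
Proof.
apply/jacobiator_eq0; rewrite !split_bracketMM !compr_split_MM compl_split_MM.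
by rewrite sigma12_pstmap3 -pstmap3N -pstmap3D pbr_jacobi.
Qed.

(** M is an ideal for the bracket, so each composition lands in the image of [inM], which can be
    cancelled. *)
Lemma jacobiator_LMM x u v : J (inL x) (inM u) (inM v) = 0 <->
  compl pbr (psi x u) v =
    compr psi x (pbr u v) - sigma12 (compr pbr u (psi x v)).
Proof.
rewrite jacobiator_eq0 !split_bracketLM !split_bracketMM compl_split_MM.
rewrite compr_split_LM compr_split_MM sigma12_pstmap3 -pstmap3N -pstmap3D.
by split=> [/pstmap3_inM_inj|->].
Qed.

Lemma jacobiator_LLM x y u : J (inL x) (inL y) (inM u) = 0 <->
  compr psi x (psi y u) - sigma12 (compr psi y (psi x u))
    - compl psi (pbr x y) u = compl pbr (chi x y) u.
Proof.
rewrite jacobiator_eq0 !split_bracketLM !split_bracketLL !complD //.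
rewrite compl_split_MM compl_split_LM !compr_split_LM sigma12_pstmap3.
rewrite -pstmap3N -!pstmap3D.
split=> [/pstmap3_inM_inj <-|<-]; first by rewrite addrAC subrr add0r.
by rewrite addrC subrK.
Qed.

(** The component along L is the jacobiator of L, which vanishes; the component along M is the
    opposite of the third cocycle expression. *)
Lemma jacobiator_LLL x y z : J (inL x) (inL y) (inL z) = 0 <->
  compr psi x (chi y z) - sigma12 (compr psi y (chi x z))
    + sigma13 (compr psi z (chi x y))
    + compr chi x (pbr y z) - sigma12 (compr chi y (pbr x z))
    + sigma13 (compr chi z (pbr x y)) = 0.
Proof.
set E := (X in _ <-> X = 0).
suff -> : J (inL x) (inL y) (inL z) =
    pstmap3 inL (jacobiator pbr x y z) - pstmap3 inM E.
  have /jacobiator_eq0 -> := @pbr_jacobi _ _ L x y z.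
  rewrite raddf0 sub0r -pstmap3N -[0 in X in X <-> _](raddf0 (pstmap3 inM)).
  split=> [/pstmap3_inM_inj/eqP|->]; last by rewrite oppr0.
  by rewrite oppr_eq0 => /eqP.
have [hL sL] := (@pbr_pseudolinear _ _ L, @pbr_skew _ _ L).
rewrite !jacobiator_compr // !split_bracketLL !comprD // !compr_split_LL.
rewrite !compr_split_LM !sigma12D !sigma13D !sigma12_pstmap3 !sigma13_pstmap3.
rewrite /E !(pstmap3D, pstmap3N) -!opprD; congr (- _).
(* Each of the three compositions contributes a part in L, a [chi] term and a [psi] term, in this
   order. The permutation collects the parts in L, then the [psi] terms, then the [chi] terms, as in
   [E]. *)
rewrite !opprD; exact: (AC (3*3*3) ((1*4*7)*(3*6*9*2*5*8))).
Qed.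

Lemma split_jacobi :
  (forall a b c, compl split_bracket (split_bracket a b) c =
     compr split_bracket a (split_bracket b c)
       - sigma12 (compr split_bracket b (split_bracket a c))) <->
  [/\ forall x u v, compl pbr (psi x u) v =
        compr psi x (pbr u v) - sigma12 (compr pbr u (psi x v)),
      forall x y u, compr psi x (psi y u) - sigma12 (compr psi y (psi x u))
        - compl psi (pbr x y) u = compl pbr (chi x y) u
    & forall x y z,
        compr psi x (chi y z) - sigma12 (compr psi y (chi x z))
          + sigma13 (compr psi z (chi x y))
          + compr chi x (pbr y z) - sigma12 (compr chi y (pbr x z))
          + sigma13 (compr chi z (pbr x y)) = 0].
Proof.
split=> [hJ|[h1 h2 h3] a b c].
  by split=> *; [apply/jacobiator_LMM | apply/jacobiator_LLM
    | apply/jacobiator_LLL]; apply/jacobiator_eq0.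
apply/jacobiator_eq0.
have cyc := jacobiator_cycle B_lin B_skew.
have add := jacobiatorDl B_lin.
have LLL x y z : J (inL x) (inL y) (inL z) = 0 by apply/jacobiator_LLL.
have LLM x y u : J (inL x) (inL y) (inM u) = 0 by apply/jacobiator_LLM.
have LMM x u v : J (inL x) (inM u) (inM v) = 0 by apply/jacobiator_LMM.
(* Each remaining mixed type is a rotation of one already treated. *)
have LML x u y : J (inL x) (inM u) (inL y) = 0 by rewrite cyc LLM raddf0.
have MLL x u y : J (inM u) (inL x) (inL y) = 0 by rewrite cyc LML raddf0.
have MML x u v : J (inM u) (inM v) (inL x) = 0 by rewrite cyc LMM raddf0.
have MLM x u v : J (inM u) (inL x) (inM v) = 0 by rewrite cyc MML raddf0.
(* Two rotations bring the second argument to the front, one rotation the third; additivity there is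
   [add]. *)
have add2 a1 b1 b2 c1 : J a1 (b1 + b2) c1 = J a1 b1 c1 + J a1 b2 c1.
  by rewrite !(cyc a1) !(cyc c1) add !sigma13D.
have add3 a1 b1 c1 c2 : J a1 b1 (c1 + c2) = J a1 b1 c1 + J a1 b1 c2.
  by rewrite !(cyc a1) add sigma13D.
rewrite (split_pairE a) (split_pairE b) (split_pairE c) !(add, add2, add3).
by rewrite LLL LLM LMM LML MLL MML MLM jacobiator_MMM !addr0.
Qed.

End SplitBracket.

(** * The extension attached to a cocycle *)

Section CocycleExtension.
Variables (k : fieldType) (H : cocommHopfAlgType k) (L M : liePseudoalgType H).

Definition coc_bracket (c : cocycle L M) :=
  split_bracket (coc_chi c) (coc_psi c).

(** The alias depends on [c] so that the same module L (+) M can carry one Lie structure for each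
    cocycle. *)
Definition cocext (c : cocycle L M) : Type := (L * M)%type.

HB.instance Definition _ (c : cocycle L M) :=
  GRing.Lmodule.copy (cocext c) (L * M)%type.

Fact coc_jacobi (c : cocycle L M) (p q r : cocext c) :
  compl (coc_bracket c) (coc_bracket c p q) r =
  compr (coc_bracket c) p (coc_bracket c q r)
    - sigma12 (compr (coc_bracket c) q (coc_bracket c p r)).
Proof.
move: p q r; apply/(split_jacobi (coc_chi_pseudolinear c)
  (@coc_chi_skew _ _ _ _ c) (coc_psi_pseudolinear c)).
by split; [exact: coc_psi_der | exact: coc_psi_rep | exact: coc_chi_closed].
Qed.

HB.instance Definition _ (c : cocycle L M) :=
  isLiePseudoalgebra.Build k H (cocext c)
    (split_bracket_pseudolinear (coc_chi_pseudolinear c)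
      (coc_psi_pseudolinear c))
    (split_bracket_skew (coc_psi c) (@coc_chi_skew _ _ _ _ c))
    (@coc_jacobi c).

Lemma inM_hom (c : cocycle L M) :
  pseudo_hom (inM L M : {linear M -> cocext c}).
Proof.
move=> u v.
exact: split_bracketMM (coc_chi_pseudolinear c) (coc_psi_pseudolinear c) u v.
Qed.

Lemma prL_hom (c : cocycle L M) :
  pseudo_hom (prL L M : {linear cocext c -> L}).
Proof. by move=> p q; rewrite [pbr p q]/(split_bracket _ _ p q) prL_inLM. Qed.

Lemma inM_inj : injective (inM L M).
Proof. by move=> u v []. Qed.

Lemma prL_surj x : exists p, prL L M p = x.
Proof. by exists (x, 0). Qed.

Lemma prL_exact p : prL L M p = 0 <-> exists u, inM L M u = p.
Proof.
by case: p => x u; split=> /= [->|[v [<- _]]]; first by exists u.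
Qed.

Definition coc_extension (c : cocycle L M) : extension L M :=
  @Extension _ _ L M (cocext c) _ _ (@inM_hom c) (@prL_hom c) inM_inj prL_surj
    prL_exact.

Lemma coc_extension_split c : H_split (coc_extension c).
Proof. by exists (inL L M). Qed.

End CocycleExtension.

(** * Equivalence of extensions is an equivalence relation *)

Section ExtensionEquivalence.
Variables (k : fieldType) (H : cocommHopfAlgType k) (L M : liePseudoalgType H).
Implicit Types E : extension L M.

Lemma ext_i_p E u : ext_p E (ext_i E u) = 0.
Proof. by apply/(ext_exact (ext_i E u)); exists u. Qed.

Lemma ext_equiv_refl E : ext_equiv E E.
Proof.
exists idfun; split=> // x y.
by rewrite pstmap2_id.
Qed.

Lemma ext_equiv_trans E1 E2 E3 :
  ext_equiv E1 E2 -> ext_equiv E2 E3 -> ext_equiv E1 E3.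
Proof.
move=> [S [homS iS pS]] [T [homT iT pT]]; exists (T \o S); split.
- by move=> x y; rewrite [LHS]homT homS pstmap2_comp.
- by move=> u; rewrite -iT /= -iS.
- by move=> x; rewrite -pS /= -pT.
Qed.

(** By the short five lemma, proved here by diagram chase, a morphism of extensions is bijective;
    its inverse is again a homomorphism. *)
Lemma ext_equiv_sym E1 E2 : ext_equiv E1 E2 -> ext_equiv E2 E1.
Proof.
move=> [T [homT Ti pT]].
have iT u : T (ext_i E1 u) = ext_i E2 u := Ti u.
have {}pT x : ext_p E2 (T x) = ext_p E1 x := pT x.
(* An element killed by [T] lies over 0, hence comes from M, where [T] restricts to the injective
   [ext_i E2]. *)
have Tinj : injective T.
  move=> x y Txy; apply/eqP; rewrite -subr_eq0; apply/eqP.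
  have : ext_p E1 (x - y) = 0 by rewrite -pT !raddfB /= Txy subrr.
  move=> /(ext_exact (x - y)) [u uE].
  have : ext_i E2 u = 0 by rewrite -iT uE raddfB /= Txy subrr.
  by rewrite -uE -[0](raddf0 (ext_i E2)) => /ext_i_inj ->; rewrite raddf0.
(* A lift [x] of the image of [y] in L is corrected by the element of M that measures [y - T x]. *)
have Tsurj y : exists x, T x = y.
  have [x px] := ext_p_surj E1 (ext_p E2 y).
  have : ext_p E2 (y - T x) = 0 by rewrite raddfB /= pT px subrr.
  move=> /(ext_exact (y - T x)) [u uE]; exists (x + ext_i E1 u).
  by rewrite raddfD /= iT uE addrC subrK.
pose S y := projT1 (cid (Tsurj y)).
have TS y : T (S y) = y by rewrite /S; case: cid.
have linS : linear S by move=> a x y; apply: Tinj; rewrite linearP !TS.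
have ST x : S (T x) = x by apply: Tinj.
pose S' : {linear _ -> _} := linear_fun_of linS.
exists S'; split.
- move=> x y; rewrite -{2}(TS x) -{2}(TS y) homT pstmap2_comp.
  by rewrite (@eq_pstmap2 _ _ _ _ (S' \o T) idfun) // pstmap2_id.
- by move=> u; apply: Tinj; rewrite [LHS]TS -iT.
- by move=> x; rewrite /= -pT TS.
Qed.

End ExtensionEquivalence.

(** * Split extensions come from cocycles, and equivalences of the extensions are equivalences of
    cocycles *)

Section Classification.
Variables (k : fieldType) (H : cocommHopfAlgType k) (L M : liePseudoalgType H).
Local Notation N := (L * M)%type.
Local Notation inL := (inL L M).
Local Notation inM := (inM L M).
Local Notation prL := (prL L M).
Local Notation prM := (prM L M).

(** Both brackets are biadditive, and the case of M against L follows from L against M by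
    skew-symmetry. [B] is a bare bracket because its Jacobi identity will be deduced from such a
    [T]. *)
Lemma split_bracket_hom (B : N -> N -> pst2 N) (E : liePseudoalgType H)
    (T : {linear N -> E}) :
  pseudolinear B -> Defs.skew B ->
  (forall x y, pbr (T (inL x)) (T (inL y)) = pstmap2 T (B (inL x) (inL y))) ->
  (forall x u, pbr (T (inL x)) (T (inM u)) = pstmap2 T (B (inL x) (inM u))) ->
  (forall u v, pbr (T (inM u)) (T (inM v)) = pstmap2 T (B (inM u) (inM v))) ->
  forall p q, pbr (T p) (T q) = pstmap2 T (B p q).
Proof.
move=> [BDl BDr _] skB LL LM MM p q.
have [ADl ADr _] := @pbr_pseudolinear _ _ E.
have ML u x : pbr (T (inM u)) (T (inL x)) = pstmap2 T (B (inM u) (inL x)).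
  by rewrite pbr_skew skB LM pstmap2N sigma2_pstmap2.
rewrite (split_pairE p) (split_pairE q) !linearD /= !(ADl, ADr, BDl, BDr).
by rewrite !pstmap2D -LL -LM -ML -MM.
Qed.

(** The left inverse of [T] makes [pstmap3 T] injective, and [T] carries both sides to the Jacobi
    identity of [E]. *)
Lemma jacobi_pullback (B : N -> N -> pst2 N) (E : liePseudoalgType H)
    (T : {linear N -> E}) (T' : {linear E -> N}) :
  pseudolinear B -> cancel T T' ->
  (forall p q, pbr (T p) (T q) = pstmap2 T (B p q)) ->
  forall a b c, compl B (B a b) c =
    compr B a (B b c) - sigma12 (compr B b (B a c)).
Proof.
move=> hB TK hom a b c; have hE := @pbr_pseudolinear _ _ E.
have inj : injective (pstmap3 T).
  apply: (can_inj (g := pstmap3 T')) => w.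
  by rewrite pstmap3_comp (@eq_pstmap3 _ _ _ _ _ idfun) // pstmap3_id.
have comprT p w : compr pbr (T p) (pstmap2 T w) = pstmap3 T (compr B p w).
  by apply: compr_natural.
have complT w p : compl pbr (pstmap2 T w) (T p) = pstmap3 T (compl B w p).
  by apply: compl_natural.
apply: inj; rewrite pstmap3D pstmap3N -sigma12_pstmap3 -!comprT -complT -!hom.
exact: pbr_jacobi.
Qed.

Lemma H_split_coc_extension (E : extension L M) : H_split E ->
  exists c : cocycle L M, ext_equiv (coc_extension c) E.
Proof.
move=> [s sK]; set i := ext_i E; set p := ext_p E.
(* The element e - s (p e) lies over 0, hence comes from M; the choice is unique and defines the
   linear retraction [r] of [i]. *)
have exr e : exists u, i u = e - s (p e).
  by apply/(ext_exact (e - s (p e))); rewrite raddfB /= sK subrr.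
pose r0 e := projT1 (cid (exr e)).
have ir0 e : i (r0 e) = e - s (p e) by rewrite /r0; case: cid.
have linr0 : linear r0.
  move=> a x y; apply: (@ext_i_inj _ _ _ _ E); rewrite -/i linearP !ir0.
  by rewrite (linearP p) (linearP s) scalerBr opprD addrACA.
pose r : {linear _ -> _} := linear_fun_of linr0.
have ir e : i (r e) = e - s (p e) := ir0 e.
(* The decomposition of the identity of E as s p + i r, applied to tensors. *)
have split2 (w : pst2 (ext_alg E)) :
    w = pstmap2 s (pstmap2 p w) + pstmap2 i (pstmap2 r w).
  rewrite !pstmap2_comp -pstmap2_add -[LHS]pstmap2_id; apply: eq_pstmap2 => e.
  by rewrite /= ir addrC subrK.
pose chi x y := pstmap2 r (pbr (s x) (s y)).
pose psi x u := pstmap2 r (pbr (s x) (i u)).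
have hE := @pbr_pseudolinear _ _ (ext_alg E).
have chi_lin : pseudolinear chi.
  exact: pseudolinear_pstmap2 (pseudolinear_pre s s hE).
have psi_lin : pseudolinear psi.
  exact: pseudolinear_pstmap2 (pseudolinear_pre s i hE).
have chi_skew : Defs.skew chi.
  by move=> x y; rewrite /chi pbr_skew pstmap2N sigma2_pstmap2.
have B_lin := split_bracket_pseudolinear chi_lin psi_lin.
have B_skew := split_bracket_skew psi chi_skew.
pose T : {linear N -> ext_alg E} := (s \o prL) \+ (i \o prM).
have TL x : T (inL x) = s x by rewrite /T /= raddf0 addr0.
have TM u : T (inM u) = i u by rewrite /T /= raddf0 add0r.
have T_inL w : pstmap2 T (pstmap2 inL w) = pstmap2 s w.
  by rewrite pstmap2_comp; apply: eq_pstmap2 => x; exact: TL.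
have T_inM w : pstmap2 T (pstmap2 inM w) = pstmap2 i w.
  by rewrite pstmap2_comp; apply: eq_pstmap2 => u; exact: TM.
have homT : forall a b, pbr (T a) (T b) = pstmap2 T (split_bracket chi psi a b).
  apply: split_bracket_hom => // [x y|x u|u v]; rewrite ?TL ?TM.
  - rewrite split_bracketLL // pstmap2D T_inL T_inM.
    by rewrite [LHS]split2 -ext_p_hom !sK.
  (* The bracket of [s x] and [i u] lies over the bracket of [x] and 0, so only its part along [i]
     survives. *)
  - rewrite split_bracketLM // T_inM [LHS]split2 -ext_p_hom ext_i_p.
    by rewrite (pseudolinear0r _ (@pbr_pseudolinear _ _ L)) raddf0 add0r.
  - by rewrite split_bracketMM // T_inM; exact: ext_i_hom.
pose T' : {linear ext_alg E -> N} := (inL \o p) \+ (inM \o r).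
have TK : cancel T T'.
  move=> [x u]; have pT : p (T (x, u)) = x.
    by rewrite /T /= raddfD /= sK ext_i_p addr0.
  have rT : r (T (x, u)) = u.
    apply: (@ext_i_inj _ _ _ _ E).
    by rewrite -/i ir pT /T /= addrAC subrr add0r.
  rewrite [LHS]/(inL (p (T (x, u))) + inM (r (T (x, u)))) pT rT.
  exact: esym (split_pairE (x, u)).
(* The three cocycle identities are not computed in E: they are read off from the Jacobi identity
   pulled back along [T]. *)
have [h1 h2 h3] := (split_jacobi chi_lin chi_skew psi_lin).1
  (jacobi_pullback B_lin TK homT).
exists (Cocycle chi_lin chi_skew psi_lin h1 h2 h3), T; split=> //.
by move=> [x u]; rewrite /T /= linearD /= sK ext_i_p addr0.
Qed.

(** With [a] and [b] the values of the second and first [chi] and [f] the image of the bracket under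
    [phi], this matches equality of M-components with the form used in [coc_equiv]. *)
Fact chi_diff_eq (V : zmodType) (a b p q r f : V) :
  a + p - q + r = f + b <-> b - a = p - q - f + r.
Proof.
split=> h.
  have -> : b = a + p - q + r - f by rewrite h addrAC subrr add0r.
  by rewrite [LHS](ACl ((1*6)*(2*3*5*4))) /= subrr add0r.
rewrite -[b](subrK a) h.
by rewrite [RHS](AC (1*(4*1)) ((1*4)*(6*2*3*5))) /= subrr add0r.
Qed.

Section Shear.
Variables (c c' : cocycle L M) (phi : {linear L -> M}) (T : {linear N -> N}).
Hypothesis TE : forall p, T p = (p.1, phi p.1 + p.2).

Let TL x : T (inL x) = (x, phi x). Proof. by rewrite TE addr0. Qed.
Let TM u : T (inM u) = inM u. Proof. by rewrite TE raddf0 add0r. Qed.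

Let T_inM (w : pst2 M) : pstmap2 T (pstmap2 inM w) = pstmap2 inM w.
Proof. by rewrite pstmap2_comp; exact: eq_pstmap2. Qed.

Let T_inL (w : pst2 L) :
  pstmap2 T (pstmap2 inL w) = pstmap2 inL w + pstmap2 inM (pstmap2 phi w).
Proof.
rewrite !pstmap2_comp -pstmap2_add; apply: eq_pstmap2 => x /=.
by rewrite TE; congr pair; rewrite /= ?addr0 ?add0r.
Qed.

(** [T] enters through [TE] alone, so the shear lemmas serve both for a [T] built from [phi] and for
    a [phi] extracted from [T]. *)
Lemma shear_homLM x u :
  coc_bracket c' (T (inL x)) (T (inM u)) =
    pstmap2 T (coc_bracket c (inL x) (inM u))
  <-> coc_psi c x u - coc_psi c' x u = pbr (phi x) u.
Proof.
have hc := @coc_chi_pseudolinear _ _ _ _ c.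
have hp := @coc_psi_pseudolinear _ _ _ _ c.
have hL := @pbr_pseudolinear _ _ L.
have hp' := @coc_psi_pseudolinear _ _ _ _ c'.
have hc' := @coc_chi_pseudolinear _ _ _ _ c'.
have -> : coc_bracket c' (T (inL x)) (T (inM u)) =
    pstmap2 inL 0 + pstmap2 inM (coc_psi c' x u + pbr (phi x) u).
  rewrite TL TM /coc_bracket /split_bracket (pseudolinear0r _ hL).
  rewrite (pseudolinear0r _ hc') (pseudolinear0l _ hp').
  by rewrite !raddf0 ?oppr0 ?addr0 !add0r.
rewrite [coc_bracket c _ _]split_bracketLM // T_inM.
rewrite raddf0 add0r.
split=> [/(congr1 (pstmap2 prM))|<-]; last by rewrite addrC subrK.
have K (w : pst2 M) : pstmap2 prM (pstmap2 inM w) = w.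
  by rewrite -[X in pstmap2 _ X]add0r -(raddf0 (pstmap2 inL)) prM_inLM.
by rewrite !K => <-; rewrite addrC addKr.
Qed.

Lemma shear_homLL x y :
  coc_bracket c' (T (inL x)) (T (inL y)) =
    pstmap2 T (coc_bracket c (inL x) (inL y))
  <-> coc_chi c x y - coc_chi c' x y =
      coc_psi c' x (phi y) - sigma2 (coc_psi c' y (phi x))
        - pstmap2 phi (pbr x y) + pbr (phi x) (phi y).
Proof.
have hc := @coc_chi_pseudolinear _ _ _ _ c.
have hp := @coc_psi_pseudolinear _ _ _ _ c.
rewrite !TL [coc_bracket c _ _]split_bracketLL //.
rewrite pstmap2D T_inL T_inM -addrA -pstmap2D -chi_diff_eq.
by split=> [/(congr1 (pstmap2 prM))|<-//]; rewrite !prM_inLM.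
Qed.

Lemma shear_homMM u v :
  coc_bracket c' (T (inM u)) (T (inM v)) =
    pstmap2 T (coc_bracket c (inM u) (inM v)).
Proof.
rewrite !TM [LHS]split_bracketMM ?[coc_bracket c _ _]split_bracketMM ?T_inM //;
  exact: coc_chi_pseudolinear || exact: coc_psi_pseudolinear.
Qed.

End Shear.

Lemma coc_equivE (c c' : cocycle L M) :
  coc_equiv c c' <-> ext_equiv (coc_extension c) (coc_extension c').
Proof.
have hc := @coc_chi_pseudolinear _ _ _ _ c.
have hp := @coc_psi_pseudolinear _ _ _ _ c.
split=> [[phi [h1 h2]]|[T [homT iT pT]]].
  pose T : {linear N -> N} := idfun \+ (inM \o phi \o prL).
  have TE p : T p = (p.1, phi p.1 + p.2).
    by case: p => x u; congr pair; rewrite /= ?addr0 // addrC.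
  exists T; split.
  - apply: (@split_bracket_hom (coc_bracket c) (cocext c') T); last 3 first.
    + by move=> x y; apply/(shear_homLL c c' TE).
    + by move=> x u; apply/(shear_homLM c c' TE).
    + exact: (shear_homMM c c' TE).
    + exact: split_bracket_pseudolinear hc hp.
    + exact: split_bracket_skew (@coc_chi_skew _ _ _ _ c).
  - by move=> u; rewrite [LHS](TE (inM u)) /= raddf0 add0r.
  - by move=> p; rewrite [LHS](congr1 prL (TE p)).
(* Every equivalence is a shear: compatibility with the projections fixes the L-component of [T] on
   L, compatibility with the inclusions fixes [T] on M, and [phi] is the only part left free. *)
pose phi : {linear L -> M} := prM \o T \o inL.
have TE p : T p = (p.1, phi p.1 + p.2).
  have TL x : T (inL x) = (x, phi x).
    by rewrite [LHS]surjective_pairing; congr pair; exact: pT.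
  have TM u : T (inM u) = inM u by exact: iT.
  rewrite {1}(split_pairE p) linearD TL TM.
  by congr pair; rewrite /= ?addr0.
exists phi; split.
- by move=> x u; apply/(shear_homLM c c' TE); exact: homT.
- by move=> x y; apply/(shear_homLL c c' TE); exact: homT.
Qed.

End Classification.

(** * From a correspondence of representatives to a bijection of classes *)

Section Classes.
Local Open Scope classical_set_scope.

(** One map takes the preimage of a class under [F], the other the saturation of the image of a
    class. Both yield classes because [F] preserves and reflects the relations and meets every class
    of [RA]. *)
Lemma classes_bijection (A B : Type) (RA : A -> A -> Prop) (RB : B -> B -> Prop)
    (F : B -> A) :
  (forall x, RA x x) -> (forall x y, RA x y -> RA y x) ->
  (forall x y z, RA x y -> RA y z -> RA x z) ->
  (forall b b', RB b b' <-> RA (F b) (F b')) ->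
  (forall a, exists b, RA (F b) a) ->
  exists f : classes RA -> classes RB, bijective f.
Proof.
move=> refl sym trans RBE ess.
have clA (D : classes RB) : exists a,
    [set a | exists b, sval D b /\ RA (F b) a] = [set y | RA a y].
  case: D => D [b DE] /=; exists (F b); rewrite DE; apply/seteqP; split=> a /=.
    by case=> b' [/RBE]; exact: trans.
  by exists b; split=> //; apply/RBE.
have clB (C : classes RA) : exists b,
    [set b | sval C (F b)] = [set b' | RB b b'].
  case: C => C [a CE] /=; rewrite CE; have [b ba] := ess a; exists b.
  apply/seteqP; split=> b' /= h; first by apply/RBE; exact: trans h.
  by apply: trans (sym _ _ ba) _; apply/RBE.
pose f C : classes RB := exist _ [set b | sval C (F b)] (clB C).
pose g D : classes RA :=
  exist _ [set a | exists b, sval D b /\ RA (F b) a] (clA D).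
exists f, g.
- move=> [C [a CE]]; apply: eq_exist; rewrite /= CE.
  apply/seteqP; split=> a' /=; first by case=> b []; exact: trans.
  move=> aa'; have [b ba] := ess a.
  by exists b; split; [exact: sym | exact: trans aa'].
- move=> [D [b DE]]; apply: eq_exist; rewrite /= DE.
  apply/seteqP; split=> b' /=; last by exists b'; split=> //; exact: refl.
  by case=> b0 [/RBE h1 h2]; apply/RBE; exact: trans h2.
Qed.

End Classes.

Theorem theorem1 (k : fieldType) (H : cocommHopfAlgType k)
    (L M : liePseudoalgType H) :
  exists f : Ext_nab L M -> H2_nab L M, bijective f.
Proof.
(* [F] sends a cocycle to its extension, split by the inclusion of L into L (+) M. *)
apply: (@classes_bijection _ _ _ _
  (fun c : cocycle L M => exist _ _ (coc_extension_split c))) => /=.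
- by move=> E; exact: ext_equiv_refl.
- by move=> E E'; exact: ext_equiv_sym.
- by move=> E1 E2 E3; exact: ext_equiv_trans.
- exact: coc_equivE.
- by move=> [E sE]; exact: H_split_coc_extension.
Qed.
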